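(* (First Pieri rule.) Let $m$ be a positive integer, let $\nu$ be a (positive) partition, and assume that all parameters $q,s,x_1,\dots,x_m,y$ are complex numbers in the open unit disc. Then $$ \sum_{\lambda} \mathbb{F}_{\lambda}(x_1,\dots,x_m)\,\mathbb{F}^{*}_{\lambda/\nu}(y) = \left(1+\sum_{i=1}^{\infty}y^i\,\frac{(-s/y;q)_i}{(q;q)_i}\,\mathbb{F}_{(i)}(x_1,\dots,x_m)\right) \mathbb{F}_{\nu}(x_1,\dots,x_m), $$ where the left-hand sum is over all (positive) partitions $\lambda$ and $(i)$ denotes the one-row partition with single part $i$.
   Context: Fix $q,s\in\mathbb{C}$ with $|q|<1$, $|s|<1$. Write $(a;q)_m=\prod_{i=1}^m(1-aq^{i-1})$ for $m\ge 1$, $(a;q)_0=1$, $(a;q)_\infty=\prod_{i\ge1}(1-aq^{i-1})$. A (positive) partition is a finite, possibly empty, sequence $\lambda_1\ge\dots\ge\lambda_\ell\ge1$ of integers, with $\lambda_i:=0$ for $i>\ell$. Vertex weights: for $x\in\mathbb{C}$ and $i,j,k,\ell\in\mathbb{Z}_{\ge0}$, $$W_x(i,j;k,\ell)=\mathbf 1_{i+j=k+\ell}\,\mathbf 1_{i\ge\ell}\;x^\ell\frac{(-s/x;q)_\ell\,(-sx;q)_{i-\ell}\,(q;q)_k}{(q;q)_\ell\,(q;q)_{i-\ell}\,(s^2;q)_k},$$ where, here and in the claim, $x^\ell(-s/x;q)_\ell$ is read as the polynomial $\prod_{r=0}^{\ell-1}(x+sq^r)$. ($i,j,k,\ell$ are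 the numbers of paths on the bottom, left, top, right edges of the vertex.) Skew spin $q$-Whittaker polynomial: for partitions $\lambda,\mu$, $$\mathbb{F}_{\lambda/\mu}(x_1,\dots,x_n)=\sum\prod_{r=1}^n\left[x_r^{h_{r,0}}\frac{(-s/x_r;q)_{h_{r,0}}}{(q;q)_{h_{r,0}}}\prod_{c\ge1}W_{x_r}\big(v_{r-1,c},h_{r,c-1};v_{r,c},h_{r,c}\big)\right],$$ the sum running over all non-negative integers $h_{r,c}$ ($1\le r\le n$, $c\ge0$), with $h_{r,c}=0$ for all large $c$, and $v_{r,c}$ ($0\le r\le n$, $c\ge1$) subject to $v_{0,c}=\mu_c-\mu_{c+1}$ and $v_{n,c}=\lambda_c-\lambda_{c+1}$; all but finitely many vertex weights equal $W_x(0,0;0,0)=1$ in any nonzero term. (Equivalently: the partition function on columns $0,1,2,\dots$ and rows $1,\dots,n$ numbered from bottom to top, row $r$ carrying $x_r$, all left and right boundary edges empty, infinitely many paths in column $0$ with weights $W_x(\infty,0;\infty,\ell)=x^\ell\frac{(-s/x;q)_\ell(-sx;q)_\infty}{(q;q)_\ell(s^2;q)_\infty}$, divided by $\prod_{i=1}^n(-sx_i;q)_\infty/(s^2;q)_\infty$.) Put $\mathbb{F}_\lambda=\mathbb{F}_{\lambda/\varnothing}$. Dual polynomials: $$\mathbb{F}^*_{\lambda/\mu}(x_1,\dots,x_n)=\frac{\tilde c_{\lambda'}}{\tilde c_{\mu'}}\,\mathbb{F}_{\lambda/\mu}(x_1,\dots,x_n),\qquad \tilde c_{\lambda'}=\prod_{i\ge1}\frac{(s^2;q)_{\lambda_i-\lambda_{i+1}}}{(q;q)_{\lambda_i-\lambda_{i+1}}}.$$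 *)

(* Defs.v *)
From HB Require Import structures.
From mathcomp Require Import all_boot all_order all_algebra finmap.
From mathcomp Require Import all_classical all_reals topology normedtype.
From mathcomp Require Import complex summability.
Set Implicit Arguments.
Unset Strict Implicit.
Unset Printing Implicit Defensive.
Import Order.TTheory GRing.Theory Num.Theory numFieldNormedType.Exports.
Local Open Scope classical_set_scope.
Local Open Scope ring_scope.

Definition is_part (la : seq nat) : bool := sorted geq la && (0%N \notin la).

Record int_partition := IntPartition { parts :> seq nat; _ : is_part parts }.
HB.instance Definition _ := [isSub for parts].
HB.instance Definition _ := [Choice of int_partition by <:].

(* [mult la c] is the multiplicity la_(c+1) - la_(c+2) of the column length
   c + 1: parts are numbered from 0 and extended by 0. *)
Definition mult (la : seq nat) (c : nat) : nat :=
  (nth 0 la c - nth 0 la c.+1)%N.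

Section Algebra.
Variable C : fieldType.
Implicit Types q s x a : C.

(* (a; q)_m *)
Definition qpoch a q (m : nat) : C := \prod_(i < m) (1 - a * q ^+ i).

(* x^l (-s/x; q)_l, as a polynomial in x, so that x = 0 is allowed *)
Definition xpoch x s q (l : nat) : C := \prod_(r < l) (x + s * q ^+ r).

(* W_x(i, j; k, l), with i, j, k, l on the bottom, left, top, right edges *)
Definition weight q s x (i j k l : nat) : C :=
  if (i + j == k + l)%N && (l <= i)%N then
    xpoch x s q l * qpoch (- (s * x)) q (i - l) * qpoch q q k
      / (qpoch q q l * qpoch q q (i - l) * qpoch (s ^+ 2) q k)
  else 0.

(* \tilde c_{la'}; the factors with i > size la are 1 *)
Definition ctilde q s (la : seq nat) : C :=
  \prod_(i < size la)
     (qpoch (s ^+ 2) q (mult la i) / qpoch q q (mult la i)).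

End Algebra.

(* Horizontal and vertical edges of n rows. Rows are numbered from 0, and so
   are the columns carrying vertical edges: [hv.1 r c] is h_{r+1,c} and
   [hv.2 r c] is v_{r,c+1}. *)
Definition config (n : nat) : Type :=
  (('I_n -> nat -> nat) * ('I_n.+1 -> nat -> nat))%type.

Definition admissible n (la mu : seq nat) : set (config n) :=
  [set hv | [/\ forall r, \forall c \near \oo, hv.1 r c = 0%N,
                forall c, hv.2 ord0 c = mult mu c
              & forall c, hv.2 ord_max c = mult la c]].

(* The weight of row r. If hv is admissible and all its vertical edges are
   eventually 0, the partial products over columns are eventually constant;
   otherwise, by path conservation, some row has a vanishing weight. *)
Definition row_weight (C : numFieldType) n (q s : C) (x : 'I_n -> C)
    (hv : config n) (r : 'I_n) : C :=
  xpoch (x r) s q (hv.1 r 0%N) / qpoch q q (hv.1 r 0%N)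
  * limn (fun N => \prod_(c < N)
      weight q s (x r)
        (hv.2 (widen_ord (leqnSn n) r) c) (hv.1 r c)
        (hv.2 (lift ord0 r) c) (hv.1 r c.+1)).

(* F_{la/mu}(x_1, ..., x_n). Only finitely many admissible configurations have
   a nonzero weight, so the finitely supported sum is the full sum. *)
Definition sqW (C : numFieldType) n (q s : C) (la mu : seq nat)
    (x : 'I_n -> C) : C :=
  \sum_(hv \in @admissible n la mu) \prod_(r < n) row_weight q s x hv r.

(* F^*_{la/mu}(x_1, ..., x_n) *)
Definition dual_sqW (C : numFieldType) n (q s : C) (la mu : seq nat)
    (x : 'I_n -> C) : C :=
  ctilde q s la / ctilde q s mu * sqW q s la mu x.

(* Unordered (equivalently over the complex numbers, absolute) convergence *)
Definition has_sum (C : numFieldType) (I : choiceType) (f : I -> C) (S : C) :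
    Prop :=
  partial_sum f @ totally --> S.

Definition series_from (C : numFieldType) (k : nat) (a : nat -> C) (S : C) :
    Prop :=
  (fun N => \sum_(k <= i < N) a i) @ \oo --> S.

(* Main.v *)
(** One row has weight F_{la/mu}(x) = prod_i A_x(la_i - mu_i)
    B_x(mu_i - la_(i+1)) D(la_i - la_(i+1)), and in F^* the factor D is read
    off mu instead of la. The theorem is an iteration over the rows of the
    one-row skew Cauchy identity
      sum_la F_{la/mu}(x) F^*_{la/nu}(y)
        = Pi(x, y) sum_ka F_{nu/ka}(x) F^*_{mu/ka}(y).
    The latter is proved column by column: the partition functions M and K to
    the right of a column, for the two orders of the rows, satisfy M = E * K,
    where E is the convolution kernel with generating function
    (z; q)_oo / (xyz; q)_oo. This relation propagates to the next column by a
    star-star identity, which is a Sears transformation of a terminating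
    4phi3 and follows from two applications of the q-Saalschuetz sum. In the
    leftmost column, summing E * K over all parts uses that the partial sums
    of E are summable, while K has a limit given by the right-hand side; this
    is where Pi(x, y) appears. Interchanging limits and sums is Tannery's
    theorem, and taking nu empty identifies the product of the Pi(x_i, y) with
    1 + T. *)

Require Import Defs.
From mathcomp Require Import all_boot all_order all_algebra finmap.
From mathcomp Require Import all_classical all_reals topology normedtype sequences.
From mathcomp Require Import complex summability.
From mathcomp Require Import zify ring lra.
Set Implicit Arguments.
Unset Strict Implicit.
Unset Printing Implicit Defensive.
Import Order.TTheory GRing.Theory Num.Theory numFieldNormedType.Exports.
Local Open Scope ring_scope.

(** * The q-Saalschuetz sum *)

(** The value of Pi(x, y) is never computed. What matters is that the constant does not depend on
    the partitions: all of them are padded to one common length, so the constant found for [nu] is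
    also the one for the empty partition, and T is taken to be this constant minus 1. The delicate
    point is the leftmost column. The coefficients of E add up to (1; q)_oo / (xy; q)_oo = 0, while
    K(k) has in general a nonzero limit, so that the sum of E * K over all parts is of the form 0
    times infinity. Summation by parts replaces E by its partial sums, with generating function (qz;
    q)_oo / (xyz; q)_oo, and the result is the total of these times the limit of K. All other parts
    are controlled by interlacing: la_(i+1) <= nu_i leaves only the largest part unbounded. Hence
    each limit concerns a single summation index, and plain lists with bounded entries can stand in
    for partitions. *)

Section Pochhammer.
Variables (C : fieldType) (q : C).
Implicit Types a x s : C.

Lemma qpoch0 a : qpoch a q 0 = 1. Proof. by rewrite /qpoch big_ord0. Qed.

Lemma qpochS a n : qpoch a q n.+1 = qpoch a q n * (1 - a * q ^+ n).
Proof. by rewrite /qpoch big_ord_recr. Qed.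

Lemma qpochD a m n :
  qpoch a q (m + n) = qpoch a q m * qpoch (a * q ^+ m) q n.
Proof.
elim: n => [|n IHn]; first by rewrite addn0 qpoch0 mulr1.
by rewrite addnS !qpochS IHn exprD; ring.
Qed.

Lemma qpochSl a n : qpoch a q n.+1 = (1 - a) * qpoch (a * q) q n.
Proof. by rewrite -add1n qpochD qpochS qpoch0 expr0 expr1 mulr1 mul1r. Qed.

Lemma xpoch0 x s : xpoch x s q 0 = 1. Proof. by rewrite /xpoch big_ord0. Qed.

Lemma xpochS x s n : xpoch x s q n.+1 = xpoch x s q n * (x + s * q ^+ n).
Proof. by rewrite /xpoch big_ord_recr. Qed.

Lemma xpochD x s m n :
  xpoch x s q (m + n) = xpoch x s q m * xpoch x (s * q ^+ m) q n.
Proof.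
elim: n => [|n IHn]; first by rewrite addn0 xpoch0 mulr1.
by rewrite addnS !xpochS IHn exprD; ring.
Qed.

Hypothesis qfact_neq0 : forall n, qpoch q q n != 0.
Local Notation qfact := (qpoch q q).

Lemma qfactS n : qfact n.+1 = qfact n * (1 - q ^+ n.+1).
Proof. by rewrite qpochS exprS. Qed.

Definition qbin n i : C := if (i <= n)%N then qfact n / (qfact i * qfact (n - i)) else 0.

Lemma qbin_n0 n : qbin n 0 = 1.
Proof. by rewrite /qbin subn0 qpoch0 mul1r divff. Qed.

Lemma qbin_nn n : qbin n n = 1.
Proof. by rewrite /qbin leqnn subnn qpoch0 mulr1 divff. Qed.

Lemma qbin_small n i : (n < i)%N -> qbin n i = 0.
Proof. by rewrite /qbin => lt_ni; rewrite leqNgt lt_ni. Qed.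

Lemma one_subX_neq0 n : 1 - q ^+ n.+1 != 0.
Proof. by have := qfact_neq0 n.+1; rewrite qfactS mulf_eq0 => /norP[]. Qed.

Lemma qbinS n i : (i <= n)%N ->
  qbin n.+1 i.+1 = qbin n i + q ^+ i.+1 * qbin n i.+1.
Proof.
rewrite leq_eqVlt => /orP[/eqP->|lt_in].
  by rewrite !qbin_nn qbin_small ?mulr0 ?addr0.
rewrite /qbin ltnS (ltnW lt_in) lt_in subSS.
have [j ->] : exists j, n = (i + j.+1)%N by exists (n - i.+1)%N; lia.
have -> : ((i + j.+1) - i = j.+1)%N by lia.
have -> : ((i + j.+1) - i.+1 = j)%N by lia.
rewrite addnS !qfactS !exprS !exprD.
have := one_subX_neq0 i; have := one_subX_neq0 j.
have := qfact_neq0 i; have := qfact_neq0 j; rewrite !exprS => *.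
by field; apply/and4P.
Qed.

Lemma qbinS' n i : (i <= n)%N ->
  qbin n.+1 i.+1 = qbin n i.+1 + q ^+ (n - i) * qbin n i.
Proof.
rewrite leq_eqVlt => /orP[/eqP->|lt_in].
  by rewrite !qbin_nn qbin_small // subnn expr0 mulr1 add0r.
rewrite /qbin ltnS (ltnW lt_in) lt_in subSS.
have [j ->] : exists j, n = (i + j.+1)%N by exists (n - i.+1)%N; lia.
have -> : ((i + j.+1) - i = j.+1)%N by lia.
have -> : ((i + j.+1) - i.+1 = j)%N by lia.
rewrite addnS !qfactS !exprS !exprD.
have := one_subX_neq0 i; have := one_subX_neq0 j.
have := qfact_neq0 i; have := qfact_neq0 j; rewrite !exprS => *.
by field; apply/and4P.
Qed.

(* Homogeneous form with redundant parameters: no division by q, so that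
   q = 0 and negative powers of q need no separate treatment. *)
Lemma qSaalschutz (al be ga de c1 c2 d1 d2 sg : C) N :
  al * ga * sg = d1 * d2 -> be * de = sg * (c1 * c2) ->
  al * de = c2 * d1 -> be * ga = c1 * d2 ->
  \sum_(i < N.+1) qbin N i *
     (xpoch (al * ga) (- (c1 * c2)) q i
      * (xpoch c1 d1 q (N - i) * xpoch c2 d2 q (N - i))
      * qpoch (sg * q ^+ (N - i)) q i)
  = xpoch al be q N * xpoch ga de q N.
Proof.
move=> h1 h2 h3 h4; elim: N => [|N IHN].
  by rewrite big_ord1 qbin_nn !xpoch0 qpoch0 !mulr1.
pose X i := xpoch (al * ga) (- (c1 * c2)) q i
      * (xpoch c1 d1 q (N - i) * xpoch c2 d2 q (N - i))
      * qpoch (sg * q ^+ (N - i)) q i.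
(* The new factor on the product side splits the term of index [i]: [Y i] goes to index [i + 1] and
   [Z i] to index [i] of the sum for [N + 1]. *)
pose Y i := qbin N i * X i
  * ((al * ga - c1 * c2 * q ^+ i) * (1 - sg * (q ^+ (N - i) * q ^+ N))).
pose Z i := qbin N i * X i
  * (q ^+ i * (c1 + d1 * q ^+ (N - i)) * (c2 + d2 * q ^+ (N - i))).
have split_prod (i : 'I_N.+1) :
    qbin N i * X i * ((al + be * q ^+ N) * (ga + de * q ^+ N)) = Y i + Z i.
  rewrite /Y /Z -mulrDr; congr (_ * _).
  have -> : q ^+ N = q ^+ i * q ^+ (N - i).
    by rewrite -exprD subnKC // -ltnS.
  set u := q ^+ i; set v := q ^+ (N - i).
  have -> : (al + be * (u * v)) * (ga + de * (u * v))
      = al * ga + (al * de + be * ga) * (u * v) + be * de * (u * v) ^+ 2.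
    by ring.
  rewrite h2 h3 h4.
  have -> : (al * ga - c1 * c2 * u) * (1 - sg * (v * (u * v)))
    = al * ga - c1 * c2 * u - al * ga * sg * (v * (u * v))
      + c1 * c2 * u * sg * (v * (u * v)) by ring.
  by rewrite h1; ring.
rewrite !xpochS.
have -> : forall a b c d : C, a * b * (c * d) = (a * c) * (b * d).
  by move=> *; ring.
rewrite -IHN mulr_suml (eq_bigr _ (fun i _ => split_prod i)) big_split /=.
rewrite [X in _ = _ + X](_ : _ = Z 0%N + \sum_(i < N.+1) Z i.+1); last first.
  rewrite big_ord_recl [in RHS]big_ord_recr /= [Z N.+1]/Z qbin_small //.
  by rewrite !mul0r addr0.
rewrite big_ord_recl addrCA; congr (_ + _).
  rewrite /Z /X /= !qbin_n0 !subn0 !xpochS !xpoch0 !qpoch0; ring.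
rewrite -big_split /=; apply: eq_bigr => i _; rewrite -![bump 0 i]/i.+1 /Y /Z /X subSS.
have [lt_iN|] := ltnP i N; last first.
  move=> le_Ni; have -> : i = N :> nat by have := ltn_ord i; lia.
  rewrite !qbin_nn qbin_small // subnn !xpoch0 xpochS expr0 qpochS; ring.
rewrite qpochS.
have -> : (N - i = (N - i.+1).+1)%N by lia.
rewrite [qpoch (_ * q ^+ (N - i.+1)) q _]qpochSl !xpochS.
rewrite -[sg * q ^+ (N - i.+1) * q]mulrA -[q ^+ (N - i.+1) * q]exprSr.
set Q := qpoch _ q i.
have -> : sg * q ^+ (N - i.+1).+1 * q ^+ i = sg * q ^+ N.
  by rewrite -mulrA -exprD; congr (_ * _ ^+ _); lia.
(* Both sides are affine in [sg]: the constant terms agree by the Pascal rule [qbinS], the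
   coefficients of [sg] by -q^N times the other rule, [qbinS']. *)
suff key : qbin N.+1 i.+1 * (1 - sg * q ^+ N)
  = qbin N i * (1 - sg * (q ^+ (N - i) * q ^+ N))
    + q ^+ i.+1 * qbin N i.+1 * (1 - sg * q ^+ (N - i.+1)).
  have -> : (N - i.+1).+1 = (N - i)%N by lia.
  set P1 := xpoch _ _ _ _; set P2 := xpoch _ _ _ _; set P3 := xpoch _ _ _ _.
  transitivity (P1 * P2 * P3 * Q * (al * ga - c1 * c2 * q ^+ i)
     * (c1 + d1 * q ^+ (N - i.+1)) * (c2 + d2 * q ^+ (N - i.+1))
     * (qbin N.+1 i.+1 * (1 - sg * q ^+ N))); first by ring.
  by rewrite key; ring.
rewrite mulrBr mulr1 {1}qbinS ?(ltnW lt_iN) // qbinS' ?(ltnW lt_iN) //.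
have -> : q ^+ N = q ^+ i.+1 * q ^+ (N - i.+1) by rewrite -exprD subnKC.
have -> : (N - i = (N - i.+1).+1)%N by lia.
by rewrite !exprS; ring.
Qed.

End Pochhammer.

Lemma sum_window (V : nmodType) (F : nat -> V) (k N J : nat) :
  (k + N < J)%N ->
  \sum_(0 <= j < J | (k <= j <= k + N)%N) F j = \sum_(0 <= i < N.+1) F (k + i)%N.
Proof.
move=> ltJ; rewrite (@big_cat_nat _ _ _ k) //=; last by lia.
rewrite big_nat_cond big_pred0; last by move=> i; apply/negbTE; lia.
rewrite add0r (@big_cat_nat _ _ _ (k + N).+1) //=; last by lia.
rewrite [X in _ + X]big_nat_cond [X in _ + X]big_pred0; last first.
  by move=> i; apply/negbTE; lia.
rewrite addr0 -{1}[k]add0n big_addn big_nat_cond [RHS]big_nat_cond.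
rewrite (_ : (k + N).+1 - k = N.+1)%N; last by lia.
apply: eq_big => [i|i _]; last by rewrite addnC.
by apply/idP/idP; lia.
Qed.

(** * The star-star identity *)

Section StarStar.
Variables (C : fieldType) (q s : C).
Hypothesis qfact_neq0 : forall n, qpoch q q n != 0.
Hypothesis qpoch_s2_neq0 : forall n, qpoch (s ^+ 2) q n != 0.
Local Notation qfact := (qpoch q q).

Lemma qpoch_qX a n : qpoch (q ^+ a.+1) q n = qfact (a + n) / qfact a.
Proof. by rewrite qpochD -exprS mulrAC divff ?mul1r. Qed.

(** The factors of index r are q^r (q^(j-r) - 1) and q^(w+1+r) (q^(v-r) - 1). In the product of the
    two the signs cancel, and the exponents 2r + w + 1 add up to k (w + k). *)
Lemma xpoch_qX_mul j v w k : (k <= j)%N -> (k <= v)%N ->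
  xpoch (q ^+ j) (-1) q k * xpoch (q ^+ (v + w).+1) (- q ^+ w.+1) q k
  = q ^+ (k * (w + k)) * (qfact j * qfact v / (qfact (j - k) * qfact (v - k))).
Proof.
elim: k => [|k IHk] lekj lekv.
  by rewrite !xpoch0 mul0n !subn0 divff ?mulf_neq0 // !mulr1.
rewrite !xpochS mulrACA IHk ?(ltnW lekj) ?(ltnW lekv) //.
have [a ->] : exists a, j = (k + a.+1)%N by exists (j - k.+1)%N; lia.
have [b ->] : exists b, v = (k + b.+1)%N by exists (v - k.+1)%N; lia.
have -> : (k + a.+1 - k = a.+1)%N by lia.
have -> : (k + b.+1 - k = b.+1)%N by lia.
have -> : (k + a.+1 - k.+1 = a)%N by lia.
have -> : (k + b.+1 - k.+1 = b)%N by lia.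
have -> : (k.+1 * (w + k.+1) = k * (w + k) + k + k + w.+1)%N by lia.
have -> : ((k + b.+1 + w).+1 = k + b.+1 + w.+1)%N by lia.
rewrite [in RHS]exprD [_ ^+ (_ + k)]exprD [_ ^+ (_ + k)]exprD.
rewrite [qfact a.+1]qfactS [qfact b.+1]qfactS.
rewrite [q ^+ (k + _)]exprD [q ^+ (k + b.+1 + _)]exprD [q ^+ (k + _)]exprD.
have := one_subX_neq0 qfact_neq0 a; have := one_subX_neq0 qfact_neq0 b.
have := qfact_neq0 a; have := qfact_neq0 b => *.
set A := qfact (k + a.+1); set B := qfact (k + b.+1).
field; exact/and4P.
Qed.

Lemma xpoch_qX_eq0 j k : (j < k)%N -> xpoch (q ^+ j) (-1) q k = 0.
Proof.
move=> ltjk; rewrite /xpoch (bigD1 (Ordinal ltjk)) //=.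
by rewrite mulN1r subrr mul0r.
Qed.

Lemma xpochZ a x t n : xpoch (a * x) (a * t) q n = a ^+ n * xpoch x t q n.
Proof.
by elim: n => [|n IHn]; rewrite ?xpoch0 ?mulr1 // !xpochS IHn exprS; ring.
Qed.

Lemma xpoch1N a n : xpoch 1 (- a) q n = qpoch a q n.
Proof. by apply: eq_bigr => i _; rewrite mulNr. Qed.

(** This is [qSaalschutz] with all parameters equal to powers of [q] up to sign, read in the index i
    = u - k. The conditions k <= j and k <= v need no separate care: beyond them a factor q^j - q^r
    or q^v - q^r vanishes. *)
Lemma qtransform_le j w u v :
  \sum_(0 <= k < u.+1 | (k <= v)%N && (k <= j)%N)
     qfact (j + w + u + v - k) / (qfact (u - k) * qfact (v - k) * qfact k)
     * (q ^+ (k * (w + k)) / (qfact (j - k) * qfact (w + k)))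
  = qfact (j + w + v) * qfact (j + w + u) * qfact (w + u + v)
    / (qfact u * qfact v * qfact j * qfact (j + w) * qfact (w + u) * qfact (w + v)).
Proof.
have saal := @qSaalschutz C q qfact_neq0 1 (- q ^+ (j + w).+1) 1
  (- q ^+ (v + w).+1) (q ^+ j) (q ^+ (v + w).+1) (-1) (- q ^+ w.+1)
  (q ^+ w.+1) u.
have {}saal := saal ltac:(by rewrite !mul1r mulN1r opprK)
  ltac:(by rewrite mulrNN -!exprD; congr (_ ^+ _); lia)
  ltac:(by rewrite mul1r mulrN1)
  ltac:(by rewrite mulr1 mulrN -exprD addnS).
rewrite !xpoch1N !qpoch_qX in saal.
pose K := qfact u * qfact j * qfact v * qfact (w + u) / qfact (j + w + v).
have K_neq0 : K != 0 by rewrite !mulf_neq0 ?invr_eq0.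
apply: (mulfI K_neq0); rewrite mulr_sumr.
transitivity (qfact (j + w + u) / qfact (j + w) * (qfact (v + w + u) / qfact (v + w))); last first.
  rewrite /K (addnC v w) [(w + v + u)%N]addnAC.
  have := (qfact_neq0, qfact_neq0) => -[h _].
  by field; rewrite ?h.
rewrite -saal big_mkcond big_mkord (reindex_inj rev_ord_inj) /=.
apply: eq_bigr => i _; rewrite subSS.
set k := (u - i)%N.
have le_iu : (i <= u)%N by rewrite -ltnS.
have ki : (u - k = i)%N by rewrite /k; lia.
case: ifP => [/andP[lekv lekj]|]; last first.
  move=> kN; suff -> : xpoch (q ^+ j) (-1) q k
      * xpoch (q ^+ (v + w).+1) (- q ^+ w.+1) q k = 0.
    by rewrite mulr0 mul0r mulr0.
  have [ltjk|lekj] := ltnP j k; first by rewrite xpoch_qX_eq0 ?mul0r.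
  have ltvk : (v < k)%N by move: kN; lia.
  suff -> : xpoch (q ^+ (v + w).+1) (- q ^+ w.+1) q k
     = (q ^+ w.+1) ^+ k * xpoch (q ^+ v) (-1) q k.
    by rewrite [X in _ * (_ * X)]xpoch_qX_eq0 // !mulr0.
  by rewrite -xpochZ mulrN1 -exprD addnC addSn.
rewrite mulrA xpoch_qX_mul // /qbin le_iu ki -!exprD -/k.
rewrite addSn qpoch_qX mul1r addnS xpoch1N.
rewrite (_ : w + k + i = w + u)%N; last by rewrite /k; lia.
rewrite qpoch_qX (_ : j + (v + w) + i = j + w + u + v - k)%N; last by lia.
rewrite (_ : j + (v + w) = j + w + v)%N; last by lia.
have h := qfact_neq0; rewrite /K; field; rewrite ?h //.
Qed.

Lemma qtransform N u v j : (j <= N + u)%N -> (j <= N + v)%N ->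
  \sum_(0 <= k < u.+1 | (k <= v)%N && (k <= j <= k + N)%N)
     qfact (N + u + v - k) / (qfact (u - k) * qfact (v - k) * qfact k)
     * (q ^+ (k * (N - (j - k))) / (qfact (j - k) * qfact (N - (j - k))))
  = qfact (N + v) * qfact (N + u) * qfact (N + u + v - j)
    / (qfact u * qfact v * qfact j * qfact N * qfact (N + u - j) * qfact (N + v - j)).
Proof.
move=> leju lejv; have [leNj|/ltnW lejN] := leqP j N.
  have [w ->] : exists w, N = (j + w)%N by exists (N - j)%N; lia.
  rewrite (_ : j + w + u - j = w + u)%N; last by lia.
  rewrite (_ : j + w + v - j = w + v)%N; last by lia.
  rewrite (_ : j + w + u + v - j = w + u + v)%N; last by lia.
  rewrite -qtransform_le; apply: eq_big => [k|k].
    by rewrite -[(j <= _)%N]/_; apply/idP/idP; lia.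
  move=> /andP[_ /andP[lekj _]].
  by rewrite (_ : j + w - (j - k) = w + k)%N; last by lia.
(* For j > N the range starts at d = j - N. Shifting k by d gives [qtransform_le] with N and d in
   the roles of [j] and [w], and with u - d and v - d for [u] and [v]. *)
have [d jE] : exists d, j = (N + d)%N by exists (j - N)%N; lia.
have [u' uE] : exists u', u = (u' + d)%N by exists (u - d)%N; lia.
have [v' vE] : exists v', v = (v' + d)%N by exists (v - d)%N; lia.
rewrite jE {}uE {}vE.
rewrite (@big_cat_nat _ _ _ d) /=; [|lia|lia].
rewrite big_nat_cond big_pred0 ?add0r; last by move=> k; apply/negbTE; lia.
rewrite -{1}[d]add0n big_addn (_ : (u' + d).+1 - d = u'.+1)%N; last by lia.
have := qtransform_le N d u' v'.
rewrite (_ : N + (u' + d) - (N + d) = u')%N; last by lia.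
rewrite (_ : N + (v' + d) - (N + d) = v')%N; last by lia.
rewrite (_ : N + (u' + d) + (v' + d) - (N + d) = d + u' + v')%N; last by lia.
rewrite (_ : N + d + v' = N + (v' + d))%N; last by lia.
rewrite (_ : N + d + u' = N + (u' + d))%N; last by lia.
rewrite (_ : d + u' = u' + d)%N; last by lia.
rewrite (_ : d + v' = v' + d)%N; last by lia.
move=> e; transitivity (qfact (N + (v' + d)) * qfact (N + (u' + d)) * qfact (u' + d + v')
    / (qfact (u') * qfact (v') * qfact N * qfact (N + d) * qfact (u' + d) * qfact (v' + d))).
  rewrite -e; apply: eq_big => [k|k]; first by apply/idP/idP; lia.
  move=> kP; have lekN : (k <= N)%N by move: kP; lia.
  rewrite (_ : N + (u' + d) + (v' + d) - (k + d) = N + (u' + d) + v' - k)%N; last by lia.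
  rewrite (_ : u' + d - (k + d) = u' - k)%N; last by lia.
  rewrite (_ : v' + d - (k + d) = v' - k)%N; last by lia.
  rewrite (_ : N + d - (k + d) = N - k)%N; last by lia.
  rewrite (_ : N - (N - k) = k)%N; last by lia.
  rewrite (_ : (k + d) * k = k * (d + k))%N; last by lia.
  by rewrite (addnC k d); have h := qfact_neq0; field; rewrite ?h.
by have h := qfact_neq0; field; rewrite ?h.
Qed.

(* A row with parameter x has weight
   prod_i upw x (la_i - mu_i) downw x (mu_i - la_(i+1)) gapw (la_i - la_(i+1)). *)
Definition upw x n := xpoch x s q n / qfact n.
Definition downw x n := qpoch (- (s * x)) q n / qfact n.
Definition gapw n := qfact n / qpoch (s ^+ 2) q n.
(* Coefficient of z^n in (z; q)_oo / (t z; q)_oo. *)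
Definition crossw t n := xpoch t (-1) q n / qfact n.
(** Truncated subtraction would give a violated inequality the weight [f 0]; the test makes it 0, so
    that interlacing is enforced by the weights themselves. *)
Definition ext (f : nat -> C) a b : C := if (b <= a)%N then f (a - b)%N else 0.

Section Exchange.
Variables x y : C.

(* The case n >= u + v, with N = n - u - v: expand the right-hand side by
   [qtransform] and sum over j at fixed k by [qSaalschutz]. *)
Lemma exchange_add N u v :
  upw x (N + v) * upw y (N + u)
  * (\sum_(0 <= k < u.+1 | (k <= v)%N)
      gapw (N + u + v - k) * (downw x (u - k) * downw y (v - k)) * crossw (x * y) k)
  = upw x v * upw y u
  * (\sum_(0 <= j < (N + minn u v).+1)
      gapw (N + u + v - j) * (downw x (N + u - j) * downw y (N + v - j))
        * crossw (x * y) j).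
Proof.
have h := qfact_neq0; have hs := qpoch_s2_neq0.
pose G j := xpoch (x * y) (-1) q j * qpoch (- (s * x)) q (N + u - j)
  * qpoch (- (s * y)) q (N + v - j) / qpoch (s ^+ 2) q (N + u + v - j).
pose c0 := xpoch x s q v * xpoch y s q u * qfact N / (qfact (N + v) * qfact (N + u)).
pose g k := qfact (N + u + v - k) / (qfact (u - k) * qfact (v - k) * qfact k).
transitivity (\sum_(0 <= j < (N + minn u v).+1)
    \sum_(0 <= k < u.+1 | (k <= v)%N && (k <= j <= k + N)%N)
      c0 * G j * (g k *
        (q ^+ (k * (N - (j - k))) / (qfact (j - k) * qfact (N - (j - k)))))); last first.
  rewrite mulr_sumr; apply: eq_big_nat => j /andP[_ ltj].
  rewrite -mulr_sumr qtransform; [|lia|lia].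
  rewrite /c0 /G /upw /downw /gapw /crossw; field.
  by rewrite ?h ?hs.
rewrite (exchange_big_dep_nat (fun k => (k <= v)%N)) /=; last first.
  by move=> j k _ _ _ /andP[].
rewrite mulr_sumr [LHS]big_nat_cond [RHS]big_nat_cond.
apply: eq_bigr => k /andP[/andP[_ leku] lekv].
have {}leku : (k <= u)%N by [].
transitivity (\sum_(0 <= j < (N + minn u v).+1 | (k <= j <= k + N)%N)
   c0 * G j * (g k *
        (q ^+ (k * (N - (j - k))) / (qfact (j - k) * qfact (N - (j - k)))))); last first.
  by apply: eq_bigl => j; rewrite lekv.
rewrite sum_window; last by lia.
have [a uE] : exists a, u = (k + a)%N by exists (u - k)%N; lia.
have [b vE] : exists b, v = (k + b)%N by exists (v - k)%N; lia.
(* The summation index is i = j - k. With sg = s^2 q^(a+v), the last factor of [qSaalschutz] is what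
   brings 1 / (s^2; q)_(N+u+v-j) to the common denominator (s^2; q)_(N+u+v-k). *)
have saal := @qSaalschutz C q h x (s * q ^+ v) y
  (s * q ^+ u) 1 (q ^+ k) (s * q ^+ a * x) (s * q ^+ v * y)
  (s ^+ 2 * q ^+ (a + v)) N.
have {}saal := saal ltac:(by rewrite exprD; ring)
  ltac:(rewrite vE uE !exprD; ring)
  ltac:(rewrite uE !exprD; ring)
  ltac:(by rewrite mul1r).
pose W := xpoch x s q v * xpoch y s q u / (qfact (N + v) * qfact (N + u)) * g k
  * (xpoch (x * y) (-1) q k * qpoch (- (s * x)) q a * qpoch (- (s * y)) q b
     / qpoch (s ^+ 2) q (N + u + v - k)).
transitivity (W * (xpoch x (s * q ^+ v) q N * xpoch y (s * q ^+ u) q N)).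
  rewrite /W /g /upw /downw /gapw /crossw ![(N + _)%N]addnC !xpochD.
  rewrite (_ : u - k = a)%N; last by lia.
  rewrite (_ : v - k = b)%N; last by lia.
  by field; rewrite ?h ?hs.
rewrite -saal mulr_sumr big_mkord; apply: eq_bigr => -[i /= ltiN] _.
rewrite /W /c0 /G addKn /qbin -ltnS ltiN xpochD mul1r mulN1r.
rewrite (_ : N + u - (k + i) = a + (N - i))%N; last by lia.
rewrite (_ : N + v - (k + i) = b + (N - i))%N; last by lia.
rewrite [qpoch _ q (a + _)]qpochD [qpoch _ q (b + _)]qpochD.
rewrite (_ : N + u + v - k = a + v + (N - i) + i)%N; last by lia.
rewrite (_ : N + u + v - (k + i) = a + v + (N - i))%N; last by lia.
rewrite [qpoch (s ^+ 2) q (_ + i)]qpochD.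
rewrite -[s ^+ 2 * _ * q ^+ (N - i)]mulrA -[q ^+ (a + v) * _]exprD.
(* Pulling q^k out of each factor yields the power q^(k (N - i)) that [qtransform] put into the
   term. *)
rewrite -[X in xpoch X (s * q ^+ v * y) q _](mulr1 (q ^+ k)).
rewrite (_ : s * q ^+ v * y = q ^+ k * (s * q ^+ b * y)); last first.
  by rewrite vE exprD; ring.
rewrite xpochZ -exprM.
rewrite (_ : s * q ^+ a * x = - (- (s * x) * q ^+ a)); last by ring.
rewrite (_ : s * q ^+ b * y = - (- (s * y) * q ^+ b)); last by ring.
rewrite !xpoch1N.
have := hs (a + v + (N - i) + i)%N; rewrite qpochD mulf_eq0 => /norP[hs1 hs2].
by field; rewrite ?h hs1 hs2.
Qed.

Let S n u v := \sum_(0 <= j < n.+1 | (j <= u)%N && (j <= v)%N)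
  gapw (n - j) * (downw x (u - j) * downw y (v - j)) * crossw (x * y) j.

(** The substitution (u, v) -> (n - v, n - u) interchanges the two sides of the identity and turns u
    + v >= n into u + v <= n, the case covered by [exchange_add]. *)
Lemma exchange_le n u v : (u <= n)%N -> (v <= n)%N ->
  upw x (n - u) * upw y (n - v) * S n u v
  = upw x v * upw y u * S n (n - v) (n - u).
Proof.
have core a b : (a + b <= n)%N -> upw x (n - a) * upw y (n - b) * S n a b
  = upw x b * upw y a * S n (n - b) (n - a).
  move=> leabn; have := exchange_add (n - (a + b)) a b.
  set N := (n - (a + b))%N.
  rewrite (_ : N + b = n - a)%N; last by rewrite /N; lia.
  rewrite (_ : N + a = n - b)%N; last by rewrite /N; lia.
  rewrite (_ : n - b + b = n)%N; last by lia.
  move=> e; transitivity (upw x (n - a) * upw y (n - b) *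
    (\sum_(0 <= k < a.+1 | (k <= b)%N)
      gapw (n - k) * (downw x (a - k) * downw y (b - k)) * crossw (x * y) k)).
    congr (_ * _); rewrite [RHS](big_nat_widen _ _ n.+1); last by lia.
    by apply: eq_bigl => k; rewrite ltnS andbC.
  rewrite e; congr (_ * _); rewrite (big_nat_widen _ _ n.+1); last first.
    by rewrite /N; lia.
  by apply: eq_bigl => k /=; rewrite /N; apply/idP/idP; lia.
move=> leun levn; have [|/ltnW ltn] := leqP (u + v) n; first exact: core.
have := core (n - v)%N (n - u)%N ltac:(lia).
by rewrite !subKn // => ->.
Qed.

(** Both sides vanish unless k' <= u, v <= r, and translating all labels by [k'] then gives
    [exchange_le]. Since no order is assumed among the labels, the identity can be used under
    sums. *)
Lemma exchange_lattice J r k' u v : (r < J)%N ->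
  ext (upw x) r u * ext (upw y) r v *
    (\sum_(0 <= j < J) ext gapw r j * (ext (downw x) u j * ext (downw y) v j)
       * ext (crossw (x * y)) j k')
  = \sum_(0 <= k < J) ext (crossw (x * y)) r k
      * (ext (downw x) k v * ext (downw y) k u * ext gapw k k')
      * (ext (upw x) v k' * ext (upw y) u k').
Proof.
move=> ltrJ.
have [leur|ltru] := leqP u r; last first.
  rewrite {1}/ext leqNgt ltru !mul0r big1 // => k _.
  rewrite /ext; have [lekr|] := leqP k r; last by rewrite !mul0r.
  by rewrite [(u <= k)%N]leqNgt (leq_ltn_trans lekr ltru) /= !(mulr0, mul0r).
have [levr|ltrv] := leqP v r; last first.
  rewrite {2}/ext [(v <= r)%N]leqNgt ltrv /= !(mulr0, mul0r) big1 // => k _.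
  rewrite /ext; have [lekr|] := leqP k r; last by rewrite !mul0r.
  by rewrite [(v <= k)%N]leqNgt (leq_ltn_trans lekr ltrv) /= !(mulr0, mul0r).
have [leku|ltuk] := leqP k' u; last first.
  rewrite [X in _ * X]big1 ?mulr0 => [|j _]; last first.
    rewrite /ext; have [leju|] := leqP j u; last by rewrite !(mulr0, mul0r).
    by rewrite [(k' <= j)%N]leqNgt (leq_ltn_trans leju ltuk) /= !mulr0.
  rewrite big1 // => k _.
  by rewrite [ext _ u k']/ext [(k' <= u)%N]leqNgt ltuk /= !mulr0.
have [lekv|ltvk] := leqP k' v; last first.
  rewrite [X in _ * X]big1 ?mulr0 => [|j _]; last first.
    rewrite /ext; have [lejv|] := leqP j v; last by rewrite !(mulr0, mul0r).
    by rewrite [(k' <= j)%N]leqNgt (leq_ltn_trans lejv ltvk) /= !mulr0.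
  rewrite big1 // => k _.
  by rewrite [ext _ v k']/ext [(k' <= v)%N]leqNgt ltvk /= !(mulr0,mul0r).
have [n rE] : exists n, r = (k' + n)%N by exists (r - k')%N; lia.
have [a uE] : exists a, u = (k' + a)%N by exists (u - k')%N; lia.
have [b vE] : exists b, v = (k' + b)%N by exists (v - k')%N; lia.
have window (F : nat -> C) : (forall j, ~~ (k' <= j <= k' + n)%N -> F j = 0) ->
    \sum_(0 <= j < J) F j = \sum_(0 <= i < n.+1) F (k' + i)%N.
  move=> F0; have <- := @sum_window _ F k' n J ltac:(lia).
  rewrite [RHS]big_mkcond; apply: eq_bigr => j _.
  by case: ifP => // /negbT/F0.
rewrite [X in _ * X]window; last first.
  move=> j jP; rewrite /ext; have [leju|] := leqP j u; last by rewrite !(mulr0, mul0r).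
  by rewrite [(k' <= j)%N](_ : _ = false) ?mulr0 //; apply/negbTE; lia.
rewrite [RHS]window; last first.
  move=> j jP; rewrite /ext; have [lejr|] := leqP j r; last by rewrite !(mulr0, mul0r).
  rewrite [(k' <= j)%N](_ : _ = false) ?(mulr0, mul0r) //; apply/negbTE; lia.
(* The crossing weight on the right depends on r - k, while in [exchange_le] it depends on the index
   itself. *)
rewrite [in RHS]big_nat_rev /= -mulr_suml.
have := @exchange_le n a b ltac:(lia) ltac:(lia).
move=> e; rewrite {1 2}/ext leur levr uE vE rE !subnDl.
transitivity (upw x (n - a) * upw y (n - b) * S n a b).
  congr (_ * _); rewrite /S [RHS]big_mkcond; apply: eq_big_nat => i /andP[_ lein].
  rewrite /ext !leq_add2l leq_addr (_ : i <= n)%N // !subnDl addKn.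
  by case: (i <= a)%N; case: (i <= b)%N => //=; rewrite !(mulr0, mul0r).
rewrite e mulrC; congr (_ * _); last by rewrite /ext !leq_addr !addKn.
rewrite /S big_mkcond; apply: eq_big_nat => i /andP[_ lein].
rewrite add0n subSS /ext !leq_add2l leq_addr leq_subr !subnDl addKn.
rewrite (_ : n - (n - i) = i)%N; last by lia.
rewrite -[(i <= n - b)%N]/_ (_ : (i <= n - b)%N = (b <= n - i)%N); last first.
  by apply/idP/idP; lia.
rewrite (_ : (i <= n - a)%N = (a <= n - i)%N); last by apply/idP/idP; lia.
rewrite (_ : n - b - i = n - i - b)%N; last by lia.
rewrite (_ : n - a - i = n - i - a)%N; last by lia.
by case: (b <= _)%N; case: (a <= _)%N => //=; ring.
Qed.

End Exchange.

End StarStar.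

(** * Rows on padded partitions *)

(** The lists need not be sorted: row weights vanish unless the lists interlace, and a rectangular
    range lets sums be taken one coordinate at a time. *)
Fixpoint box (N L : nat) : seq (seq nat) :=
  if L is L'.+1 then [seq a :: t | a <- index_iota 0 N.+1, t <- box N L']
  else [:: [::]].

Lemma boxS N L :
  box N L.+1 = [seq a :: t | a <- index_iota 0 N.+1, t <- box N L].
Proof. by []. Qed.

Lemma big_boxS (V : nmodType) (F : seq nat -> V) N L :
  \sum_(la <- box N L.+1) F la
  = \sum_(0 <= a < N.+1) \sum_(t <- box N L) F (a :: t).
Proof. by rewrite boxS big_allpairs_dep. Qed.

Lemma mem_box N L la :
  (la \in box N L) = (size la == L) && all (leq^~ N) la.
Proof.
elim: L la => [|L IHL] [|a la] //; rewrite boxS.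
  by apply/negbTE/negP => /allpairsP[[b t] [_ _]].
apply/allpairsP/idP => [[[b t] [+ + [-> ->]]]|/andP[sza /andP[lea lla]]].
  by rewrite mem_index_iota IHL /= ltnS => -> /andP[/eqP-> ->]; rewrite eqxx.
exists (a, la); split => //; first by rewrite mem_index_iota /= ltnS.
by rewrite IHL; apply/andP.
Qed.

Lemma box_uniq N L : uniq (box N L).
Proof.
elim: L => [|L IHL] //; rewrite boxS allpairs_uniq ?iota_uniq //.
by move=> [a t] [b u] _ _ /= [-> ->].
Qed.

Lemma big_box_sub (V : nmodType) (F : seq nat -> V) N M L : (M <= N)%N ->
  (forall la, size la = L -> ~~ all (leq^~ M) la -> F la = 0) ->
  \sum_(la <- box N L) F la = \sum_(la <- box M L) F la.
Proof.
move=> leMN F0; rewrite (bigID (all (leq^~ M))) /= [X in _ + X]big_seq_cond.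
rewrite [X in _ + X]big1 ?addr0 => [|la]; last first.
  by rewrite mem_box => /andP[/andP[/eqP + _]]; apply: F0.
rewrite -big_filter; apply: perm_big; apply: uniq_perm.
- by rewrite filter_uniq ?box_uniq.
- exact: box_uniq.
move=> la; rewrite mem_filter !mem_box; case: eqP => //= _; last by rewrite andbF.
case: allP => //= leM; apply/allP => a /leM leaM; exact: leq_trans leMN.
Qed.

Lemma big_nat_cut (V : nmodType) (F : nat -> V) a b : (forall i, (a < i)%N || (b < i)%N -> F i = 0) ->
  \sum_(0 <= i < a.+1) F i = \sum_(0 <= i < b.+1) F i.
Proof.
wlog leab : a b / (a <= b)%N.
  move=> H F0; have [leab|/ltnW leba] := leqP a b; first exact: H.
  by apply/esym/H => // i; rewrite orbC; apply: F0.
move=> F0; rewrite [RHS](@big_cat_nat _ _ _ a.+1) //= [X in _ + X]big_nat_cond.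
rewrite [X in _ + X]big1 ?addr0 // => i /andP[/andP[lt_ai _] _].
by rewrite F0 // lt_ai.
Qed.

Section Rows.
Variables (C : fieldType) (q s : C).
Local Notation qfact := (qpoch q q).

Fixpoint rowU x (la mu : seq nat) : C :=
  match la, mu with
  | l :: la', m :: mu' => ext (upw q s x) l m * ext (downw q s x) m (head 0%N la')
      * ext (gapw q s) l (head 0%N la') * rowU x la' mu'
  | [::], [::] => 1
  | _, _ => 0
  end.

Fixpoint rowV y (la nu : seq nat) : C :=
  match la, nu with
  | l :: la', n :: nu' => ext (upw q s y) l n * ext (downw q s y) n (head 0%N la')
      * ext (gapw q s) n (head 0%N nu') * rowV y la' nu'
  | [::], [::] => 1
  | _, _ => 0
  end.

Fixpoint gaps (nu : seq nat) : C :=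
  if nu is n :: nu' then ext (gapw q s) n (head 0%N nu') * gaps nu' else 1.

Lemma ext_neq0 (f : nat -> C) a b : ext f a b != 0 -> (b <= a)%N.
Proof. by rewrite /ext; case: ifP => // _; rewrite eqxx. Qed.

Lemma ext_small (f : nat -> C) a b : (a < b)%N -> ext f a b = 0.
Proof. by rewrite /ext => ltab; rewrite leqNgt ltab. Qed.

Lemma ext_0 (f : nat -> C) a : ext f a 0 = f a.
Proof. by rewrite /ext subn0. Qed.

Lemma ext_id (f : nat -> C) a : ext f a a = f 0%N.
Proof. by rewrite /ext leqnn subnn. Qed.

Hypothesis qfact_neq0 : forall n, qpoch q q n != 0.
Hypothesis qpoch_s2_neq0 : forall n, qpoch (s ^+ 2) q n != 0.

Lemma up0 x : upw q s x 0 = 1.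
Proof. by rewrite /upw xpoch0 qpoch0 divr1. Qed.
Lemma down0 x : downw q s x 0 = 1.
Proof. by rewrite /downw !qpoch0 divr1. Qed.
Lemma gap0 : gapw q s 0 = 1.
Proof. by rewrite /gapw !qpoch0 divr1. Qed.
Lemma cross0 t : crossw q t 0 = 1.
Proof. by rewrite /crossw xpoch0 qpoch0 divr1. Qed.

(** * Two rows in either order, column by column *)

Section TwoRows.
Variables x y : C.

(* [Msum] and [Ksum] are the partition functions to the right of a column for
   the two orders of the rows, with the gapw factors of nu removed; past the
   end of the lists all parts are 0. *)
Fixpoint Msum N (mu nu : seq nat) r : C :=
  match mu, nu with
  | m :: mu', n :: nu' => ext (upw q s x) r m * ext (upw q s y) r n *
      \sum_(0 <= j < N.+1) ext (gapw q s) r j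
        * (ext (downw q s x) m j * ext (downw q s y) n j) * Msum N mu' nu' j
  | _, _ => upw q s x r * upw q s y r * gapw q s r
  end.

Fixpoint Ksum (mu nu : seq nat) k : C :=
  match mu, nu with
  | m :: mu', n :: nu' => ext (downw q s x) k n * ext (downw q s y) k m *
      \sum_(0 <= j < n.+1) ext (gapw q s) k j
        * (ext (upw q s x) n j * ext (upw q s y) m j) * Ksum mu' nu' j
  | _, _ => downw q s x k * downw q s y k * gapw q s k
  end.

Lemma Msum_Ksum N mu nu r : size mu = size nu -> (r <= N)%N ->
  Msum N mu nu r
  = \sum_(0 <= k < N.+1) ext (crossw q (x * y)) r k * Ksum mu nu k.
Proof.
elim: mu nu r => [|m mu IHmu] [|n nu] // r.
  (* Past the end all parts are 0: the base case is the star-star identity with u = v = k' = 0,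
     whose left-hand sum is reduced to j = 0. *)
  move=> /= _ lerN; have e := exchange_lattice qfact_neq0 qpoch_s2_neq0
    x y 0 0 0 (lerN : (r < N.+1)%N).
  transitivity (\sum_(0 <= k < N.+1) ext (crossw q (x * y)) r k *
    (ext (downw q s x) k 0 * ext (downw q s y) k 0 * ext (gapw q s) k 0) *
    (ext (upw q s x) 0 0 * ext (upw q s y) 0 0)).
    rewrite -e !ext_0; congr (_ * _); rewrite big_ltn // !ext_0 big_nat_cond.
    rewrite big1 => [|j]; first by rewrite addr0 !down0 cross0 !mulr1.
    case/andP => /andP[lt0j _] _.
    by rewrite [ext (downw q s x) 0 j]ext_small ?(mulr0, mul0r).
  by apply: eq_bigr => k _; rewrite !ext_0 !up0 !mulr1 mulrA.
move=> /= [sz] lerN.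
set A := ext _ r m * _.
pose G j := ext (gapw q s) r j * (ext (downw q s x) m j * ext (downw q s y) n j).
(* The induction hypothesis puts a crossing between [j] and [k']. Summing over [j] first exposes the
   left-hand side of [exchange_lattice], which moves the crossing to the left of the column. *)
transitivity (\sum_(0 <= k' < N.+1)
   (A * \sum_(0 <= j < N.+1) G j * ext (crossw q (x * y)) j k')
   * Ksum mu nu k').
  under [in RHS]eq_bigr do rewrite mulr_sumr mulr_suml.
  rewrite exchange_big mulr_sumr; apply: eq_big_nat => j /andP[_ lejN] /=.
  rewrite (IHmu nu j sz lejN) !mulr_sumr; apply: eq_bigr => k' _.
  by rewrite /G; ring.
have ltrN : (r < N.+1)%N by [].
rewrite /A /G.
transitivity (\sum_(0 <= k' < N.+1) (\sum_(0 <= k < N.+1)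
  ext (crossw q (x * y)) r k
      * (ext (downw q s x) k n * ext (downw q s y) k m * ext (gapw q s) k k')
      * (ext (upw q s x) n k' * ext (upw q s y) m k')) * Ksum mu nu k').
  apply: eq_bigr => k' _; congr (_ * _).
  exact: (exchange_lattice qfact_neq0 qpoch_s2_neq0 x y k' m n ltrN).
under [LHS]eq_bigr do rewrite mulr_suml.
rewrite exchange_big; apply: eq_big_nat => k /andP[_ lekN] /=.
rewrite (@big_nat_cut _ _ n N) => [|j].
  by rewrite !mulr_sumr; apply: eq_bigr => j _; ring.
case/orP => ltj.
  by rewrite [ext (upw q s x) n j]ext_small ?(mulr0, mul0r).
rewrite [ext (gapw q s) k j]ext_small ?(mulr0, mul0r) //.
exact: leq_ltn_trans ltj.
Qed.

Lemma big_nat_cut2 k N n (F : nat -> C) :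
  (k <= N)%N ->
  \sum_(0 <= j < N.+1) ext (gapw q s) k j * (ext (upw q s x) n j * F j)
  = \sum_(0 <= j < n.+1) ext (gapw q s) k j * (ext (upw q s x) n j * F j).
Proof.
move=> lekN; apply: big_nat_cut => j /orP[ltNj|ltnj].
  by rewrite ext_small ?mul0r //; apply: leq_ltn_trans ltNj.
by rewrite [X in _ * (X * _)]ext_small ?mul0r ?mulr0.
Qed.

(** The appended 0 makes room for the one additional part that [la] may have. The gaps of [nu] do
    not involve [la] and come out of the sum. *)
Lemma sum_rowUV N mu nu r : size mu = size nu ->
  \sum_(t <- box N (size mu)) rowU x (r :: t) (rcons mu 0%N) *
     rowV y (r :: t) (rcons nu 0%N)
  = gaps (rcons nu 0%N) * Msum N mu nu r.
Proof.
elim: mu nu r => [|m mu IHmu] [|n nu] // r.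
  by move=> _; rewrite big_seq1 /= !ext_0 !down0 gap0 !mulr1 !mul1r mulrAC.
move=> [sz]; rewrite big_boxS rcons_cons [rcons (n :: nu) _]rcons_cons.
transitivity (\sum_(0 <= a < N.+1) ext (upw q s x) r m * ext (upw q s y) r n
   * ext (gapw q s) n (head 0%N (rcons nu 0%N))
   * (ext (gapw q s) r a * (ext (downw q s x) m a * ext (downw q s y) n a))
   * (gaps (rcons nu 0%N) * Msum N mu nu a)).
  apply: eq_bigr => a _; rewrite -IHmu // mulr_sumr; apply: eq_bigr => t _.
  rewrite -[rowU _ (r :: _) _]/(_ * rowU x (a :: t) (rcons mu 0%N)).
  rewrite -[rowV _ (r :: _) _]/(_ * rowV y (a :: t) (rcons nu 0%N)).
  by rewrite -[head 0%N (a :: t)]/a; ring.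
rewrite /= !mulr_sumr; apply: eq_bigr => a _; ring.
Qed.

Lemma sum_box_rowUV N mu nu : size mu = size nu ->
  \sum_(la <- box N (size mu).+1) rowU x la (rcons mu 0%N) *
     rowV y la (rcons nu 0%N)
  = gaps (rcons nu 0%N) * \sum_(0 <= r < N.+1)
      \sum_(0 <= k < N.+1) ext (crossw q (x * y)) r k * Ksum mu nu k.
Proof.
move=> sz; rewrite big_boxS mulr_sumr; apply: eq_big_nat => r /andP[_ lerN].
by rewrite sum_rowUV // Msum_Ksum.
Qed.

(** The displayed [gapw] and [downw] factors are those by which [rowU] and [rowV] attach the tail
    [t] to a preceding part [k]; they belong to [Ksum]. *)
Lemma Ksum_rows N mu nu k : size mu = size nu -> (k <= N)%N ->
  \sum_(t <- box N (size mu).+1)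
     ext (gapw q s) k (head 0%N t) *
      (rowU x (rcons nu 0%N) t * rowV y (rcons mu 0%N) t)
     * (ext (downw q s x) k (head 0%N (rcons nu 0%N))
        * ext (downw q s y) k (head 0%N (rcons mu 0%N)))
  = gaps (rcons nu 0%N) * Ksum mu nu k.
Proof.
elim: mu nu k => [|m mu IHmu] [|n nu] // k.
  move=> _ lekN; rewrite big_boxS big_ltn // big_seq1 /=.
  rewrite !ext_0 !down0 !up0 !gap0 !mulr1 !mul1r.
  rewrite big_nat_cond big1 ?addr0 => [|j]; first by ring.
  case/andP => /andP[lt0j _] _; rewrite big_seq1 /=.
  by rewrite [ext (upw q s x) 0 j]ext_small // !(mul0r, mulr0).
move=> [sz] lekN; rewrite big_boxS.
transitivity (\sum_(0 <= a < N.+1) ext (downw q s x) k n * ext (downw q s y) k m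
   * ext (gapw q s) n (head 0%N (rcons nu 0%N))
   * (ext (gapw q s) k a * (ext (upw q s x) n a * ext (upw q s y) m a))
   * (gaps (rcons nu 0%N) * Ksum mu nu a)).
  apply: eq_big_nat => a /andP[_ leaN]; rewrite -IHmu // mulr_sumr.
  by apply: eq_bigr => t _; rewrite !rcons_cons /=; ring.
transitivity (gaps (rcons (n :: nu) 0%N) * (ext (downw q s x) k n
   * ext (downw q s y) k m * (\sum_(0 <= j < N.+1) ext (gapw q s) k j
     * (ext (upw q s x) n j * (ext (upw q s y) m j * Ksum mu nu j))))).
  by rewrite rcons_cons /= !mulr_sumr; apply: eq_bigr => a _; ring.
rewrite big_nat_cut2 //=; congr (_ * (_ * _)).
by apply: eq_bigr => j _; ring.
Qed.

(** This is what remains of [Ksum] as [k] tends to infinity, once the factors that depend on [k] are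
    replaced by their limits. *)
Definition Ktop mu nu : C :=
  match mu, nu with
  | m :: mu', n :: nu' =>
      \sum_(0 <= j < n.+1) ext (upw q s x) n j * ext (upw q s y) m j
        * Ksum mu' nu' j
  | _, _ => 1
  end.

Lemma sum_box_rowVU N mu nu : size mu = size nu -> (head 0 nu <= N)%N ->
  \sum_(ka <- box N (size mu).+1) rowU x (rcons nu 0%N) ka *
     rowV y (rcons mu 0%N) ka
  = gaps (rcons nu 0%N) * Ktop mu nu.
Proof.
case: mu nu => [|m mu] [|n nu] //.
  move=> _ _; rewrite big_boxS big_ltn // big_seq1 /=.
  rewrite !ext_0 !down0 !up0 !gap0 !mulr1.
  rewrite big_nat_cond big1 ?addr0 // => j.
  case/andP => /andP[lt0j _] _; rewrite big_seq1 /=.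
  by rewrite [ext (upw q s x) 0 j]ext_small // !(mul0r, mulr0).
move=> [sz] lenN; rewrite big_boxS; rewrite /= in lenN *.
rewrite (@big_nat_cut _ _ N n) => [|j /orP[ltNj|ltnj]].
- rewrite !mulr_sumr; apply: eq_big_nat => a /andP[_ lean].
  have leaN : (a <= N)%N by apply: leq_trans lenN.
  transitivity (ext (gapw q s) n (head 0%N (rcons nu 0%N))
     * (ext (upw q s x) n a * ext (upw q s y) m a)
     * (gaps (rcons nu 0%N) * Ksum mu nu a)); last by ring.
  rewrite -(@Ksum_rows N) // mulr_sumr; apply: eq_bigr => t _.
  by rewrite /=; ring.
- rewrite big1 // => t _; rewrite /= [ext (upw q s x) n j]ext_small ?mul0r //.
  exact: leq_ltn_trans ltNj.
- by rewrite big1 // => t _; rewrite /= [ext (upw q s x) n j]ext_small ?mul0r.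
Qed.

End TwoRows.
End Rows.

Local Open Scope classical_set_scope.
Local Open Scope complex_scope.

(** * Series of complex numbers *)

Section ComplexSeries.
Variable R : realType.
Local Notation C := (R[i] : numFieldType).
Local Notation nrm := (@Normc.normc R).
Implicit Types (u v : nat -> C) (z l : C).

Lemma normr_nrm z : `|z| = (nrm z)%:C.
Proof. by case: z => a b; rewrite normc_def. Qed.

Lemma nrm_ge0 z : 0 <= nrm z.
Proof. by case: z => a b; apply: sqrtr_ge0. Qed.

Lemma nrm0 : nrm 0 = 0. Proof. exact: Normc.normc0. Qed.
Lemma nrm1 : nrm 1 = 1. Proof. exact: Normc.normc1. Qed.

Lemma ler_nrmD z l : nrm (z + l) <= nrm z + nrm l.
Proof. exact: (@le_normcD R). Qed.

Lemma nrmN z : nrm (- z) = nrm z. Proof. exact: (@normcN R). Qed.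
Lemma nrmM z l : nrm (z * l) = nrm z * nrm l. Proof. exact: Normc.normcM. Qed.
Lemma nrmB z l : nrm (z - l) = nrm (l - z). Proof. by rewrite -nrmN opprB. Qed.

Lemma ler_nrm_sum (I : Type) (r : seq I) (P : pred I) (F : I -> C) :
  nrm (\sum_(i <- r | P i) F i) <= \sum_(i <- r | P i) nrm (F i).
Proof.
elim/big_rec2: _ => [|i x y _ le_yx]; first by rewrite nrm0.
by rewrite (le_trans (ler_nrmD _ _)) // lerD2l.
Qed.

Lemma nrm_lt1 z : `|z| < 1 -> nrm z < 1.
Proof. by rewrite normr_nrm -[1]/(1%:C) ltcR. Qed.

(** The norm on [C] is itself complex-valued, so its epsilons are complex numbers with zero
    imaginary part; all estimates below use real ones. *)
Lemma climP u l : u @ \oo --> l <->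
  (forall e : R, 0 < e -> exists N, forall n, (N <= n)%N -> nrm (u n - l) < e).
Proof.
split=> [/cvgrPdist_lt ul e e0|ul].
  have e0C : 0 < e%:C by rewrite ltcR.
  have [N _ HN] := ul _ e0C; exists N => n leNn.
  by have := HN n leNn; rewrite /= normr_nrm ltcR nrmB.
apply/cvgrPdist_lt => e; rewrite ltcE /= => /andP[/eqP Ime Ree].
have [N HN] := ul _ Ree; exists N => // n leNn.
rewrite /= normr_nrm nrmB ltcE /= HN // andbT; apply/eqP.
by move: Ime.
Qed.

Lemma expr_cvg0 z : nrm z < 1 -> (fun n => z ^+ n) @ \oo --> (0 : C).
Proof.
move=> z1; have n1 : `|nrm z| < 1 by rewrite ger0_norm ?nrm_ge0.
have /cvgrPdist_lt h := cvg_expr n1.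
apply/climP => e /h[N _ HN]; exists N => n /HN /=.
rewrite sub0r normrN subr0 ger0_norm ?exprn_ge0 ?nrm_ge0 //.
suff -> : nrm (z ^+ n) = nrm z ^+ n by [].
by elim: n => [|n IHn]; rewrite ?nrm1 // !exprS nrmM IHn.
Qed.

Lemma cvg_nrm_bounded u l : u @ \oo --> l ->
  exists B : R, forall n, nrm (u n) <= B.
Proof.
move=> /climP/(_ 1 ltr01)[N HN].
exists (\sum_(0 <= n < N) nrm (u n) + (nrm l + 1)) => n.
have s_ge0 : 0 <= \sum_(0 <= n < N) nrm (u n).
  by apply: sumr_ge0 => i _; apply: nrm_ge0.
have [leNn|ltnN] := leqP N n; last first.
  rewrite big_mkord (bigD1 (Ordinal ltnN)) //= -addrA lerDl addr_ge0 //.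
    by apply: sumr_ge0 => i _; apply: nrm_ge0.
  by rewrite addr_ge0 ?nrm_ge0.
rewrite -[u n](subrK l) addrC (le_trans (ler_nrmD _ _)) //.
by have := ltW (HN _ leNn); lra.
Qed.

Lemma cvg_lsum (I : Type) (r : seq I) (f : I -> nat -> C) (l : I -> C) :
  (forall i, f i @ \oo --> l i) ->
  (fun n => \sum_(i <- r) f i n) @ \oo --> (\sum_(i <- r) l i : C).
Proof.
move=> fl; elim: r => [|i r IHr].
  by rewrite big_nil; under eq_fun do rewrite big_nil; apply: cvg_cst.
by rewrite big_cons; under eq_fun do rewrite big_cons; apply: cvgD IHr.
Qed.

Definition bounded_nrm_series u :=
  exists B : R, forall N, \sum_(0 <= n < N) nrm (u n) <= B.

Lemma bounded_nrm_series_dom u v B : 0 <= B ->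
  (forall n, nrm (v n) <= B * nrm (u n)) ->
  bounded_nrm_series u -> bounded_nrm_series v.
Proof.
move=> B0 le_vu [B' uB']; exists (B * B') => N.
apply: (@le_trans _ _ (B * \sum_(0 <= n < N) nrm (u n))).
  by rewrite mulr_sumr; apply: ler_sum.
by rewrite ler_wpM2l.
Qed.

Lemma bounded_nrm_series_sum (I : Type) (r : seq I) (f : I -> nat -> C) :
  (forall i, bounded_nrm_series (f i)) ->
  bounded_nrm_series (fun n => \sum_(i <- r) f i n).
Proof.
move=> fB; elim: r => [|i r [B IHB]].
  by exists 0 => N; rewrite big1 // => n _; rewrite big_nil nrm0.
have [B' fB'] := fB i; exists (B' + B) => N.
apply: le_trans (lerD (fB' N) (IHB N)).
rewrite -big_split; apply: ler_sum => n _.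
by rewrite big_cons ler_nrmD.
Qed.

Lemma bounded_nrm_series_conv u v : bounded_nrm_series u ->
  bounded_nrm_series v ->
  bounded_nrm_series (fun n => \sum_(0 <= h < n.+1) u h * v (n - h)%N).
Proof.
move=> [A uA] [B vB]; exists (A * B) => N.
have A0 : 0 <= A by have := uA 0%N; rewrite big_geq.
have B0 : 0 <= B by have := vB 0%N; rewrite big_geq.
apply: (@le_trans _ _ (\sum_(0 <= h < N) nrm (u h) *
    \sum_(0 <= j < N - h) nrm (v j))); last first.
  apply: (@le_trans _ _ (\sum_(0 <= h < N) nrm (u h) * B)).
    by apply: ler_sum => h _; rewrite ler_wpM2l ?nrm_ge0.
  by rewrite -mulr_suml ler_wpM2r.
apply: (@le_trans _ _ (\sum_(0 <= n < N) \sum_(0 <= h < N | (h <= n)%N)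
    nrm (u h) * nrm (v (n - h)%N))).
  rewrite big_nat [leRHS]big_nat; apply: ler_sum => n /andP[_ ltnN].
  apply: (le_trans (ler_nrm_sum _ _ _)).
  rewrite (big_nat_widen 0 n.+1 N) //=.
  by apply: ler_sum => h _; rewrite nrmM.
rewrite (exchange_big_dep_nat xpredT) //= big_nat [leRHS]big_nat.
apply: ler_sum => h /andP[_ lthN].
rewrite mulr_sumr (@big_cat_nat _ _ _ h) //=; last exact: ltnW.
rewrite big_nat_cond big_pred0 ?add0r; last first.
  by move=> n; apply/negbTE/negP => /andP[/andP[_ /ltn_geF->]].
rewrite -{1}[h]add0n big_addn big_mkcond; apply: ler_sum => j _.
by rewrite leq_addl addnK.
Qed.

Lemma nrm_series_ndec u :
  {homo (fun N => \sum_(0 <= n < N) nrm (u n)) : m n / (m <= n)%N >-> m <= n}.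
Proof.
move=> m n lemn; rewrite (@big_cat_nat _ _ _ m 0 n) //= lerDl.
by apply: sumr_ge0 => i _; apply: nrm_ge0.
Qed.

Lemma bounded_nrm_series_tail u : bounded_nrm_series u ->
  forall e : R, 0 < e ->
  exists M, forall N, (M <= N)%N -> \sum_(M <= n < N) nrm (u n) < e.
Proof.
move=> [B uB] e e0.
have /cvgrPdist_lt h : cvgn (fun N => \sum_(0 <= n < N) nrm (u n)).
  by apply: nondecreasing_is_cvgn;
    [exact: nrm_series_ndec | exists B => _ [N _ <-]].
have e2 : 0 < e / 2 by lra.
have [M _ HM] := h _ e2; exists M => N leMN.
have := HM M (leqnn _); have := HM N leMN; rewrite /=.
rewrite (@big_cat_nat _ _ _ M 0 N) //=.
by rewrite !ltr_norml; lra.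
Qed.

Lemma bounded_nrm_series_cvg u : bounded_nrm_series u ->
  exists l : C, (fun N => \sum_(0 <= n < N) u n) @ \oo --> l.
Proof.
move=> [B uB].
have part (f : C -> R) : (forall z, `|f z| <= nrm z) ->
    cvgn (series (fun n => f (u n))).
  move=> le_f; apply: normed_cvg; apply: nondecreasing_is_cvgn.
    by apply: nondecreasing_series => n _ _; apply: normr_ge0.
  exists B => _ [N _ <-]; apply: le_trans (uB N).
  by rewrite /series /=; apply: ler_sum => n _; apply: le_f.
have /cvgrPdist_lt hRe := @part (@complex.Re R) ltac:(
  by case=> a b /=; rewrite -sqrtr_sqr ler_sqrt ?lerDl ?addr_ge0 ?sqr_ge0).
have /cvgrPdist_lt hIm := @part (@complex.Im R) ltac:(
  by case=> a b /=; rewrite -sqrtr_sqr ler_sqrt ?lerDr ?addr_ge0 ?sqr_ge0).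
set a := limn _ in hRe; set b := limn _ in hIm.
exists (a +i* b); apply/climP => e e0.
have e2 : 0 < e / 2 by lra.
have [N1 _ HN1] := hRe _ e2; have [N2 _ HN2] := hIm _ e2.
exists (maxn N1 N2) => n; rewrite geq_max => /andP[/HN1 /= h1 /HN2 /= h2].
have le_nrm z : nrm z <= `|complex.Re z| + `|complex.Im z|.
  case: z => c d /=; rewrite -[leRHS]ger0_norm ?addr_ge0 // -sqrtr_sqr.
  rewrite ler_sqrt ?sqr_ge0 // sqrrD !real_normK ?num_real //.
  by rewrite addrAC lerDl mulrn_wge0 // mulr_ge0.
apply: (le_lt_trans (le_nrm _)).
have ReE : complex.Re (\sum_(0 <= i < n) u i) = \sum_(0 <= i < n) complex.Re (u i).
  exact: (raddf_sum (@complex.Re R)).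
have ImE : complex.Im (\sum_(0 <= i < n) u i) = \sum_(0 <= i < n) complex.Im (u i).
  exact: (raddf_sum (@complex.Im R)).
move: h1 h2; rewrite /series /= -ReE -ImE.
case: (\sum_(0 <= i < n) u i) => c d /=; rewrite distrC => h1; rewrite distrC => h2.
by lra.
Qed.

Lemma ratio_test u (c : nat -> C) (c0 : C) :
  (forall n, u n.+1 = u n * c n) -> c @ \oo --> c0 -> nrm c0 < 1 ->
  bounded_nrm_series u.
Proof.
move=> uS /climP cc0 c01.
pose rho := (1 + nrm c0) / 2.
have rho1 : rho < 1 by rewrite /rho; lra.
have rho0 : 0 <= rho by rewrite /rho; have := nrm_ge0 c0; lra.
have [N HN] := cc0 ((1 - nrm c0) / 2) ltac:(lra).
have le_rho n : (N <= n)%N -> nrm (c n) <= rho.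
  move=> /HN h; rewrite -[c n](subrK c0) (le_trans (ler_nrmD _ _)) // /rho.
  by move: h; lra.
(* The partial sum plus the geometric bound |u| / (1 - rho) for the remainder does not increase with
   [k]. *)
have step k : \sum_(N <= n < N + k) nrm (u n) + nrm (u (N + k)%N) / (1 - rho)
    <= nrm (u N) / (1 - rho).
  elim: k => [|k IHk]; first by rewrite addn0 big_geq ?add0r.
  apply: le_trans IHk; rewrite addnS big_nat_recr ?leq_addr //= -addrA lerD2l.
  rewrite uS nrmM; set x := nrm (u _).
  have x0 : 0 <= x by apply: nrm_ge0.
  have -> : x / (1 - rho) = x + x * rho / (1 - rho) by field; lra.
  rewrite lerD2l ler_wpM2r ?invr_ge0 ?subr_ge0 ?(ltW rho1) //.
  by rewrite ler_wpM2l // le_rho ?leq_addr.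
exists (\sum_(0 <= n < N) nrm (u n) + nrm (u N) / (1 - rho)) => M.
apply: (@le_trans _ _ (\sum_(0 <= n < N + M) nrm (u n))).
  by apply: nrm_series_ndec; apply: leq_addl.
rewrite (@big_cat_nat _ _ _ N) ?leq_addr //= lerD2l.
apply: le_trans (step M); rewrite lerDl divr_ge0 ?nrm_ge0 //.
by rewrite subr_ge0 ltW.
Qed.

Lemma tannery u (d : nat -> nat -> C) (B : R) : bounded_nrm_series u ->
  (forall N n, (n <= N)%N -> nrm (d N n) <= B) ->
  (forall n, (fun N => d N n) @ \oo --> (0 : C)) ->
  (fun N => \sum_(0 <= n < N.+1) u n * d N n) @ \oo --> (0 : C).
Proof.
move=> uB dB d0; apply/climP => e e0.
have B0 : 0 <= B by apply: le_trans (dB 0 0 isT)%N; apply: nrm_ge0.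
(* Dividing by B + 1 rather than [B] covers B = 0. *)
have eB0 : 0 < e / 2 / (B + 1) by rewrite divr_gt0 //; lra.
have [M HM] := bounded_nrm_series_tail uB eB0.
have : (fun N => \sum_(0 <= n < M) u n * d N n) @ \oo --> (0 : C).
  rewrite [X in _ --> X](_ : _ = \sum_(0 <= n < M) u n * 0); last first.
    by rewrite big1 // => n _; rewrite mulr0.
  apply: cvg_lsum => n; apply: cvgM (d0 n); apply: cvg_cst.
move=> /climP/(_ (e / 2) ltac:(lra))[N1 HN1].
exists (maxn M N1) => N; rewrite geq_max => /andP[leMN /HN1].
rewrite !subr0 (@big_cat_nat _ _ _ M 0 N.+1) //=; last exact: leqW.
move=> h; apply: (le_lt_trans (ler_nrmD _ _)).
have : nrm (\sum_(M <= n < N.+1) u n * d N n) <=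
   B * \sum_(M <= n < N.+1) nrm (u n).
  apply: (le_trans (ler_nrm_sum _ _ _)); rewrite mulr_sumr.
  rewrite big_nat [leRHS]big_nat; apply: ler_sum => n /andP[_ ltnN].
  by rewrite nrmM mulrC ler_wpM2r ?nrm_ge0 ?dB.
have := HM N.+1 (leqW leMN); set S := \sum_(M <= n < _) _ => hS hB.
have : B * S <= B * (e / 2 / (B + 1)) by rewrite ler_wpM2l // ltW.
have : B * (e / 2 / (B + 1)) <= e / 2.
  rewrite mulrCA ger_pMr; last lra.
  by rewrite ler_pdivrMr ?mul1r; lra.
by move: h hB; lra.
Qed.

End ComplexSeries.

(** * The one-row skew Cauchy identity *)

Section Limits.
Variable R : realType.
Local Notation C := (R[i] : numFieldType).
Local Notation nrm := (@Normc.normc R).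
Implicit Types (u v : nat -> C) (z l : C).

Lemma cvg_affine (q a b : C) : nrm q < 1 ->
  (fun n => a - b * q ^+ n) @ \oo --> (a : C).
Proof.
move=> q1; rewrite -[X in _ --> X]subr0 -[X in _ - X](mulr0 b).
by apply: cvgB; [exact: cvg_cst|apply: cvgM; [exact: cvg_cst|exact: expr_cvg0]].
Qed.

(** The ratios of [v] tend to 1, but those of its successive differences tend to [q], so the
    differences are summable. This gives the limits of [downw] and [gapw] without infinite
    products. *)
Lemma cvg_qratio (q a b : C) v : nrm q < 1 -> (forall n, 1 - b * q ^+ n != 0) ->
  (forall n, v n.+1 = v n * ((1 - a * q ^+ n) / (1 - b * q ^+ n))) ->
  exists l : C, v @ \oo --> l.
Proof.
move=> q1 b0 vS.
pose d n := v n.+1 - v n.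
have dS n : d n.+1 = d n * (q * ((1 - a * q ^+ n) / (1 - b * q ^+ n.+1))).
  rewrite /d !vS; have := b0 n; have := b0 n.+1; rewrite exprS => h1 h2.
  by field; rewrite h1 h2.
have [l dl] : exists l : C, (fun N => \sum_(0 <= n < N) d n) @ \oo --> l.
  apply: bounded_nrm_series_cvg; apply: (ratio_test dS _ q1).
  rewrite -[X in _ --> X]mulr1; apply: cvgM; first exact: cvg_cst.
  rewrite -[X in _ --> X]divr1; apply: cvgM; first exact: cvg_affine.
  apply: cvgV; first exact: oner_neq0.
  rewrite (_ : (fun n => _) = fun n => 1 - (b * q) * q ^+ n).
    exact: cvg_affine.
  by apply/funext => n; rewrite exprS mulrA.
exists (v 0%N + l); set v0 := v 0%N.
rewrite (_ : v = fun N => v0 + \sum_(0 <= n < N) d n).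
  by apply: cvgD dl; apply: cvg_cst.
by apply/funext => N; rewrite telescope_sumr // addrC subrK.
Qed.

Lemma one_sub_neq0 z : nrm z < 1 -> 1 - z != 0.
Proof.
by apply: contraTneq => /eqP; rewrite subr_eq0 => /eqP <-; rewrite nrm1 ltxx.
Qed.

Lemma nrm_exp z n : nrm (z ^+ n) = nrm z ^+ n.
Proof. by elim: n => [|n IHn]; rewrite ?nrm1 // !exprS nrmM IHn. Qed.

Variables q s : C.
Hypotheses (q1 : nrm q < 1) (s1 : nrm s < 1).
Local Notation qfact := (qpoch q q).

Lemma one_subM_neq0 z n : nrm z < 1 -> 1 - z * q ^+ n != 0.
Proof.
move=> z1; apply: one_sub_neq0; rewrite nrmM nrm_exp.
rewrite (le_lt_trans _ z1) // ler_piMr ?nrm_ge0 //.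
by rewrite exprn_ile1 ?nrm_ge0 // ltW.
Qed.

Lemma qpoch_neq0 z n : nrm z < 1 -> qpoch z q n != 0.
Proof.
by move=> z1; apply/prodf_neq0 => i _; apply: one_subM_neq0.
Qed.

Lemma qfact_neq0 n : qfact n != 0. Proof. exact: qpoch_neq0. Qed.

Lemma s2_lt1 : nrm (s ^+ 2) < 1.
Proof. by rewrite nrm_exp exprn_ilt1 ?nrm_ge0. Qed.

Lemma qpoch_s2_neq0 n : qpoch (s ^+ 2) q n != 0.
Proof. exact: qpoch_neq0 s2_lt1. Qed.

Lemma one_subq_neq0 n : 1 - q * q ^+ n != 0.
Proof. exact: one_subM_neq0. Qed.

Lemma xpoch_bounded_series z t : nrm z < 1 ->
  bounded_nrm_series (fun n => xpoch z t q n / qfact n).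
Proof.
move=> z1; pose c n := (z - (- t) * q ^+ n) / (1 - q * q ^+ n).
apply: (@ratio_test _ _ c z) => // [n|].
  rewrite /c xpochS qpochS mulNr opprK.
  by field; rewrite one_subq_neq0 qfact_neq0.
rewrite -[X in _ --> X]divr1; apply: cvgM; first exact: cvg_affine.
by apply: cvgV; [exact: oner_neq0|exact: cvg_affine].
Qed.

Lemma up_bounded_series x : nrm x < 1 -> bounded_nrm_series (upw q s x).
Proof. exact: xpoch_bounded_series. Qed.

Lemma down_cvg x : exists l : C, downw q s x @ \oo --> l.
Proof.
apply: (@cvg_qratio q (- (s * x)) q) => // [n|n]; first exact: one_subq_neq0.
rewrite /downw !qpochS; field; rewrite one_subq_neq0 qfact_neq0 //.
Qed.

Lemma gap_cvg : exists l : C, gapw q s @ \oo --> l.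
Proof.
apply: (@cvg_qratio q q (s ^+ 2)) => // [n|n].
  exact: one_subM_neq0 s2_lt1.
rewrite /gapw !qpochS; field.
by rewrite qpoch_s2_neq0 one_subM_neq0 ?s2_lt1.
Qed.

Lemma bounded_series_bounded u : bounded_nrm_series u ->
  exists B : R, forall n, nrm (u n) <= B.
Proof.
move=> [B uB]; exists B => n; apply: le_trans (uB n.+1).
by rewrite big_nat_recr //= lerDr sumr_ge0 // => i _; apply: nrm_ge0.
Qed.

(* Coefficient of z^n in (q z; q)_oo / (t z; q)_oo. *)
Definition cross_sum t n := xpoch t (- q) q n / qfact n.

(** Taking partial sums divides the generating function by 1 - z, which is the first factor of (z;
    q)_oo. *)
Lemma sum_cross t n : \sum_(0 <= j < n.+1) crossw q t j = cross_sum t n.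
Proof.
elim: n => [|n IHn]; first by rewrite big_nat1 /cross_sum /crossw !xpoch0.
rewrite big_nat_recr //= IHn /cross_sum /crossw.
have -> : xpoch t (-1) q n.+1 = (t - 1) * xpoch t (- q) q n.
  rewrite -add1n xpochD xpochS xpoch0 expr0 expr1 mul1r mulr1.
  by rewrite mulN1r.
rewrite xpochS qpochS; field.
by rewrite one_subq_neq0 qfact_neq0.
Qed.

Lemma ext_bounded u : (exists B : R, forall n, nrm (u n) <= B) ->
  exists2 B : R, 0 <= B & forall a b, nrm (ext u a b) <= B.
Proof.
move=> [B uB]; have B0 : 0 <= B by apply: le_trans (uB 0%N); apply: nrm_ge0.
by exists B => // a b; rewrite /ext; case: ifP => // _; rewrite nrm0.
Qed.

Lemma ext_cvg u l b : u @ \oo --> l -> (fun a => ext u a b) @ \oo --> l.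
Proof.
move=> ul; rewrite -(cvg_shiftn b) /=.
rewrite (_ : (fun n => _) = u) //; apply/funext => n.
by rewrite /ext leq_addl addnK.
Qed.

Lemma cvg_sub_idx u l j :
  u @ \oo --> l -> (fun N => u (N - j)%N) @ \oo --> l.
Proof.
move=> /climP ul; apply/climP => e /ul[N HN].
by exists (N + j)%N => n le; apply: HN; lia.
Qed.

Section Cauchy.
Variables x y : C.
Hypotheses (x1 : nrm x < 1) (y1 : nrm y < 1).

Lemma Ksum_cvg (dx dy g : C) mu nu : size mu = size nu ->
  downw q s x @ \oo --> dx -> downw q s y @ \oo --> dy -> gapw q s @ \oo --> g ->
  Ksum q s x y mu nu @ \oo --> (dx * dy * g * Ktop q s x y mu nu : C).
Proof.
case: mu nu => [|m mu] [|n nu] sz xl yl gl; try discriminate sz.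
  rewrite /= mulr1.
  exact: (cvgM (cvgM xl yl) gl).
rewrite /= -mulrA.
apply: cvgM; first exact: (cvgM (ext_cvg _ xl) (ext_cvg _ yl)).
rewrite mulr_sumr; apply: cvg_lsum => j; rewrite mulrA.
exact: (cvgM (cvgM (ext_cvg _ gl) (cvg_cst _)) (cvg_cst _)).
Qed.

(** The bound has to be uniform in [mu], because [pieri_step] sums over the largest part of [mu]. It
    can be, since the sums in [Ksum] range over labels bounded by the parts of [nu]. *)
Lemma Ksum_bounded nu : exists B : R, forall mu k, size mu = size nu ->
  nrm (Ksum q s x y mu nu k) <= B.
Proof.
have bnd u l : u @ \oo --> l -> exists2 B : R, 0 <= B &
  forall a b, nrm (ext u a b) <= B by move=> /cvg_nrm_bounded/ext_bounded.
have [_ /bnd[Dx Dx0 hDx]] := down_cvg x.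
have [_ /bnd[Dy Dy0 hDy]] := down_cvg y.
have [_ /bnd[G G0 hG]] := gap_cvg.
have [Ux Ux0 hUx] := ext_bounded (bounded_series_bounded (up_bounded_series x1)).
have [Uy Uy0 hUy] := ext_bounded (bounded_series_bounded (up_bounded_series y1)).
elim: nu => [|n nu [B IHB]].
  exists (Dx * Dy * G) => -[|//] k _ /=; rewrite 2!nrmM.
  have := hDx k 0%N; have := hDy k 0%N; have := hG k 0%N; rewrite !ext_0 => *.
  do ?[exact: nrm_ge0 | assumption | apply: mulr_ge0 | apply: ler_pM].
exists (Dx * Dy * \sum_(0 <= j < n.+1) (G * (Ux * Uy) * B)) => -[//|m mu] k [sz].
rewrite /= !nrmM; apply: ler_pM; rewrite ?mulr_ge0 ?nrm_ge0 //.
  by apply: ler_pM; rewrite ?nrm_ge0.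
apply: (le_trans (ler_nrm_sum _ _ _)); apply: ler_sum => j _.
have := IHB _ j sz; rewrite !nrmM => *.
by do ![exact: nrm_ge0 | assumption | apply: mulr_ge0 | apply: ler_pM | done].
Qed.

(** Summation by parts: for fixed [k] the sum over [r] is a partial sum of [crossw] up to j = N -
    k. *)
Lemma sum_cross_conv N (K : nat -> C) t :
  \sum_(0 <= r < N.+1) \sum_(0 <= k < N.+1) ext (crossw q t) r k * K k
  = \sum_(0 <= j < N.+1) cross_sum t j * K (N - j)%N.
Proof.
rewrite exchange_big [RHS]big_nat_rev /=; apply: eq_big_nat => k /andP[_ ltkN].
rewrite add0n subSS subKn // -mulr_suml -sum_cross; congr (_ * _).
rewrite (@big_cat_nat _ _ _ k 0 N.+1) //=; last exact: ltnW.
rewrite big_nat_cond big1 ?add0r => [|r /andP[/andP[_ ltrk] _]]; last first.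
  by rewrite ext_small.
rewrite -{1}[k]add0n big_addn (_ : N.+1 - k = (N - k).+1)%N; last by lia.
by apply: eq_bigr => r _; rewrite /ext leq_addl addnK.
Qed.

Lemma xy_lt1 : nrm (x * y) < 1.
Proof. by rewrite nrmM mulr_ilt1 ?nrm_ge0. Qed.

Lemma rowUV_bounded nu : exists B : R, forall N mu, size mu = size nu ->
  nrm (\sum_(la <- box N (size mu).+1) rowU q s x la (rcons mu 0%N) *
     rowV q s y la (rcons nu 0%N)) <= B.
Proof.
have [B KB] := Ksum_bounded nu.
have [A SA] : bounded_nrm_series (cross_sum (x * y)).
  exact: xpoch_bounded_series xy_lt1.
exists (nrm (gaps q s (rcons nu 0%N)) * (A * B)) => N mu sz.
have B0 : 0 <= B by apply: le_trans (KB mu 0%N sz); apply: nrm_ge0.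
rewrite sum_box_rowUV ?sum_cross_conv //;
  [|exact: qfact_neq0|exact: qpoch_s2_neq0].
rewrite nrmM ler_wpM2l ?nrm_ge0 // (le_trans (ler_nrm_sum _ _ _)) //.
apply: (@le_trans _ _ (\sum_(0 <= j < N.+1) nrm (cross_sum (x * y) j) * B)).
  by apply: ler_sum => j _; rewrite nrmM ler_wpM2l ?nrm_ge0 ?KB.
by rewrite -mulr_suml ler_wpM2r.
Qed.

Lemma rowUV_cvg : exists P : C, forall mu nu, size mu = size nu ->
  (fun N => \sum_(la <- box N (size mu).+1) rowU q s x la (rcons mu 0%N) *
     rowV q s y la (rcons nu 0%N)) @ \oo -->
  (P * (gaps q s (rcons nu 0%N) * Ktop q s x y mu nu) : C).
Proof.
have [dx hx] := down_cvg x; have [dy hy] := down_cvg y; have [g hg] := gap_cvg.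
have SB : bounded_nrm_series (cross_sum (x * y)).
  exact: xpoch_bounded_series xy_lt1.
have [sg hsg] := bounded_nrm_series_cvg SB.
(* Here [sg] is the value of (qz; q)_oo / (xyz; q)_oo at z = 1, so the constant is (-sx; q)_oo (-sy;
   q)_oo / ((s^2; q)_oo (xy; q)_oo). Only its independence of [mu] and [nu] matters. *)
exists (dx * dy * g * sg) => mu nu sz.
have hK := Ksum_cvg sz hx hy hg; set k0 := _ * Ktop _ _ _ _ _ _ in hK.
(* Subtracting the limit [k0] from [Ksum] leaves terms that tend to 0, as [tannery] requires. *)
rewrite (_ : (fun N => _) = fun N => gaps q s (rcons nu 0%N) *
   (\sum_(0 <= j < N.+1) cross_sum (x * y) j * (Ksum q s x y mu nu (N - j)%N - k0)
    + (\sum_(0 <= j < N.+1) cross_sum (x * y) j) * k0)); last first.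
  apply/funext => N; rewrite sum_box_rowUV ?sum_cross_conv //;
    [|exact: qfact_neq0|exact: qpoch_s2_neq0].
  congr (_ * _); rewrite mulr_suml -big_split; apply: eq_bigr => j _ /=.
  by rewrite -mulrDr subrK.
rewrite (_ : dx * dy * g * sg * _ = gaps q s (rcons nu 0%N) * (0 + sg * k0));
  last by rewrite /k0; ring.
apply: cvgM; first exact: cvg_cst.
apply: cvgD; last first.
  by rewrite -cvg_shiftS in hsg; exact: (cvgM hsg (cvg_cst k0)).
have [B KB] := Ksum_bounded nu.
apply: (@tannery _ _ (fun N j => Ksum q s x y mu nu (N - j)%N - k0) (B + nrm k0)).
- exact: SB.
- by move=> N j _; rewrite (le_trans (ler_nrmD _ _)) // nrmN lerD2r KB.
- move=> j; rewrite -[X in _ --> X](subrr k0).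
  by apply: cvgB (cvg_cst _); apply: cvg_sub_idx.
Qed.

End Cauchy.
End Limits.

(** * Iteration over the rows *)

Definition interlace (la mu : seq nat) := forall i,
  (nth 0%N mu i <= nth 0%N la i)%N /\ (nth 0%N la i.+1 <= nth 0%N mu i)%N.

Lemma interlace_head la mu : interlace la mu ->
  forall i, (nth 0%N la i <= nth 0%N la 0)%N.
Proof.
move=> lm; elim=> [//|i IHi]; have [h1 h2] := lm i.
exact: leq_trans h2 (leq_trans h1 IHi).
Qed.

Lemma all_leP N (la : seq nat) :
  reflect (forall i, (nth 0%N la i <= N)%N) (all (leq^~ N) la).
Proof.
apply: (iffP (all_nthP 0%N)) => [h i|h i _]; last exact: h.
by have [/h//|le] := ltnP i (size la); rewrite nth_default.
Qed.

Lemma all_le_sumn la : all (leq^~ (sumn la)) la.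
Proof.
apply/all_leP; elim: la => [|a la IHla] [|i] //=; first exact: leq_addr.
exact: leq_trans (IHla i) (leq_addl _ _).
Qed.

Lemma big_box_supp (V : nmodType) (F : seq nat -> V) N M L :
  (forall la, size la = L -> F la <> 0 -> all (leq^~ N) la /\ all (leq^~ M) la) ->
  \sum_(la <- box N L) F la = \sum_(la <- box M L) F la.
Proof.
wlog leMN : N M / (M <= N)%N.
  move=> H F0; have [leMN|/ltnW leNM] := leqP M N; first exact: H.
  by apply/esym/H => // la sz /(F0 la sz)[].
move=> F0; apply: big_box_sub => // la sz nle.
by apply: contrapT => /(F0 la sz)[_ h]; rewrite h in nle.
Qed.

Section RowSupport.
Variables (C : fieldType) (q s : C).

Lemma rowU_neq0 x la mu : rowU q s x la mu != 0 ->
  size la = size mu /\ interlace la mu.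
Proof.
elim: la mu => [|l la IHla] [|m mu]; rewrite /= ?eqxx //.
rewrite !mulf_eq0 !negb_or => /andP[/andP[/andP[/ext_neq0 lm /ext_neq0 ml] _]].
move=> /IHla[sz lamu]; split; first by rewrite sz.
move=> -[|i] /=; last exact: lamu.
by rewrite nth0.
Qed.

Lemma rowV_neq0 y la nu : rowV q s y la nu != 0 ->
  size la = size nu /\ interlace la nu.
Proof.
elim: la nu => [|l la IHla] [|n nu]; rewrite /= ?eqxx //.
rewrite !mulf_eq0 !negb_or => /andP[/andP[/andP[/ext_neq0 lm /ext_neq0 ml] _]].
move=> /IHla[sz lanu]; split; first by rewrite sz.
move=> -[|i] /=; last exact: lanu.
by rewrite nth0.
Qed.

(* The top row, hence the last variable, comes first in the list. *)
Fixpoint rows (xs : seq C) (la : seq nat) : C :=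
  if xs is x :: xs' then
    \sum_(mu <- box (sumn la) (size la)) rows xs' mu * rowU q s x la mu
  else (all (eq_op^~ 0%N) la)%:R.

(** The bound [sumn la] in [rows] is merely one that can be read off [la]; interlacing makes any
    other bound on the parts equivalent. *)
Lemma rows_consE N x xs la : all (leq^~ N) la ->
  rows (x :: xs) la
  = \sum_(mu <- box N (size la)) rows xs mu * rowU q s x la mu.
Proof.
move=> /all_leP laN; apply: big_box_supp => mu _ /eqP.
rewrite mulf_eq0 negb_or => /andP[_ /rowU_neq0[_ lamu]].
have /all_leP lasum := all_le_sumn la.
split; apply/all_leP => i; have [le _] := lamu i; apply: leq_trans le _.
  exact: lasum.
exact: laN.
Qed.

Lemma sum_neq0_ex (I : eqType) (r : seq I) (F : I -> C) :
  \sum_(i <- r) F i != 0 -> exists2 i, i \in r & F i != 0.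
Proof.
move=> sum_neq0; have [/hasP[i ir Fi]|/hasPn r0] := boolP (has (fun i => F i != 0) r).
  by exists i.
case/eqP: sum_neq0; rewrite big_seq big1 // => i /r0.
by rewrite negbK => /eqP.
Qed.

(** Each row lengthens a partition by at most one part. *)
Lemma rows_neq0 xs la : rows xs la != 0 ->
  forall i, (size xs <= i)%N -> nth 0%N la i = 0%N.
Proof.
elim: xs la => [|x xs IHxs] la /=.
  case: allP => [la0 _|_]; last by rewrite eqxx.
  move=> i _; have [/(mem_nth 0%N)/la0/eqP//|le] := ltnP i (size la).
  by rewrite nth_default.
case/sum_neq0_ex => mu _; rewrite mulf_eq0 negb_or => /andP[/IHxs mu0].
move=> /rowU_neq0[_ lamu] [//|i] ltxi; have [_] := lamu i.
by rewrite mu0 // leqn0 => /eqP.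
Qed.

Lemma all_eq0P la : reflect (forall i, nth 0%N la i = 0%N) (all (eq_op^~ 0%N) la).
Proof.
apply: (iffP allP) => [la0 i|la0 a /(nthP 0%N)[i _ <-]]; last exact/eqP.
have [/(mem_nth 0%N)/la0/eqP//|le] := ltnP i (size la).
by rewrite nth_default.
Qed.

Lemma rowU_nseq0 x L : rowU q s x (nseq L 0%N) (nseq L 0%N) = 1.
Proof.
elim: L => //= L ->; case: L => [|L] /=;
  by rewrite !ext_id up0 down0 gap0 !mulr1.
Qed.

Lemma rowV_nseq0 y L : rowV q s y (nseq L 0%N) (nseq L 0%N) = 1.
Proof.
elim: L => //= L ->; case: L => [|L] /=;
  by rewrite !ext_id up0 down0 gap0 !mulr1.
Qed.

Lemma rows_nil la : rows [::] la = (all (eq_op^~ 0%N) la)%:R.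
Proof. by []. Qed.

Lemma rows_nil_neq0 la L : size la = L ->
  rows [::] la != 0 -> la = nseq L 0%N.
Proof.
move=> <- /=; case: allP => [la0 _|_]; last by rewrite eqxx.
by apply/all_pred1P/allP => a /la0.
Qed.

End RowSupport.

(** * Limits of the iterated sums *)

Section Pieri.
Variable R : realType.
Local Notation C := (R[i] : numFieldType).
Local Notation nrm := (@Normc.normc R).
Variables q s : C.
Hypotheses (q1 : nrm q < 1) (s1 : nrm s < 1).

(** The largest part is reached through [upw] of l - h, so adding a row is essentially a convolution
    with a summable sequence, while the smaller parts stay in a finite box that does not depend on
    [l]. *)
Lemma rows_bounded (xs : seq C) t : (forall x, x \in xs -> nrm x < 1) ->
  bounded_nrm_series (fun l => rows q s xs (l :: t)).
Proof.
elim: xs t => [|x xs IHxs] t xs1.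
  exists 1 => N; apply: (@le_trans _ _ (\sum_(0 <= l < N) (l == 0%N)%:R)).
    apply: ler_sum => l _; rewrite [rows _ _ _ _]/=.
    by case: eqP => _; case: all; rewrite ?nrm1 ?mulr0n ?nrm0.
  case: N => [|N]; first by rewrite big_geq.
  by rewrite big_ltn // big_add1 big1 ?addr0.
have x1 : nrm x < 1 by apply: xs1; rewrite inE eqxx.
have {}IHxs t' : bounded_nrm_series (fun l => rows q s xs (l :: t')).
  by apply: IHxs => z zxs; apply: xs1; rewrite inE zxs orbT.
pose w t' l h := ext (downw q s x) h (head 0%N t) * ext (gapw q s) l (head 0%N t)
   * rowU q s x t t'.
have rowsE l : rows q s (x :: xs) (l :: t) =
  \sum_(t' <- box (sumn t) (size t)) \sum_(0 <= h < l.+1)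
     rows q s xs (h :: t') * upw q s x (l - h) * w t' l h.
  rewrite [rows _ _ _ _]/= big_boxS exchange_big.
  transitivity (\sum_(t' <- box (l + sumn t) (size t)) \sum_(0 <= h < l.+1)
     rows q s xs (h :: t') * upw q s x (l - h) * w t' l h).
    apply: eq_bigr => t' _; transitivity (\sum_(0 <= h < (l + sumn t).+1)
       rows q s xs (h :: t') * (ext (upw q s x) l h * w t' l h)).
      by apply: eq_bigr => h _; rewrite /w /=; ring.
    rewrite (@big_nat_cut _ _ _ l) => [|h]; last first.
      case/orP => [lt|lt]; rewrite ext_small ?(mulr0, mul0r) //.
      by apply: leq_ltn_trans lt; apply: leq_addr.
    apply: eq_big_nat => h /andP[_ ltl].
    by rewrite /ext -ltnS ltl mulrA.
  apply: big_box_sub; first exact: leq_addl.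
  move=> t' szt' nall; rewrite big1 // => h _.
  rewrite /w; have [->|/rowU_neq0[_ tt']] := eqVneq (rowU q s x t t') 0.
    by rewrite !mulr0.
  case/negP: nall; apply/all_leP => i; have [le _] := tt' i.
  by apply: leq_trans le _; apply/all_leP; apply: all_le_sumn.
rewrite (funext rowsE).
apply: (@bounded_nrm_series_sum _ _ _ (fun t' l => \sum_(0 <= h < l.+1)
     rows q s xs (h :: t') * upw q s x (l - h) * w t' l h)) => t'.
have [_ /cvg_nrm_bounded/ext_bounded[D D0 hD]] := down_cvg s q1 x.
have [_ /cvg_nrm_bounded/ext_bounded[G G0 hG]] := gap_cvg q1 s1.
(* As [w] depends on both [h] and [l], the sum is only dominated by a convolution, that of the
   norms; these are viewed in [C] to fit [bounded_nrm_series_conv]. *)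
pose f h := (nrm (rows q s xs (h :: t')))%:C : C.
pose g h := (nrm (upw q s x h))%:C : C.
have nrmR (a : R) : 0 <= a -> nrm a%:C = a.
  by move=> a0; rewrite /= expr0n addr0 sqrtr_sqr ger0_norm.
have fB : bounded_nrm_series f.
  by apply: (bounded_nrm_series_dom ler01 _ (IHxs t')) => h;
    rewrite nrmR ?nrm_ge0 ?mul1r.
have gB : bounded_nrm_series g.
  by apply: (bounded_nrm_series_dom ler01 _ (up_bounded_series s q1 x1)) => h;
    rewrite nrmR ?nrm_ge0 ?mul1r.
have DG0 : 0 <= D * G * nrm (rowU q s x t t') by rewrite !mulr_ge0 ?nrm_ge0.
apply: (bounded_nrm_series_dom DG0 _ (bounded_nrm_series_conv fB gB)) => l.
have -> : \sum_(0 <= h < l.+1) f h * g (l - h)%N = (\sum_(0 <= h < l.+1)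
   nrm (rows q s xs (h :: t')) * nrm (upw q s x (l - h)))%:C.
  by rewrite rmorph_sum; apply: eq_bigr => h _; rewrite rmorphM.
rewrite nrmR; last by apply: sumr_ge0 => h _; rewrite mulr_ge0 ?nrm_ge0.
apply: (le_trans (ler_nrm_sum _ _ _)); rewrite mulr_sumr; apply: ler_sum => h _.
rewrite 2!nrmM mulrC ler_wpM2r ?mulr_ge0 ?nrm_ge0 // /w 2!nrmM.
by rewrite ler_wpM2r ?nrm_ge0 // ler_pM ?nrm_ge0.
Qed.

Lemma lim_nrm_le u (l : C) (B : R) :
  u @ \oo --> l -> (forall n, nrm (u n) <= B) -> nrm l <= B.
Proof.
move=> /climP ul uB; apply/ler_addgt0Pr => e /ul[N /(_ N (leqnn N)) h].
rewrite -[l](subrK (u N)) addrC (le_trans (ler_nrmD _ _)) //.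
by rewrite lerD // nrmB ltW.
Qed.

Lemma box0 L : box 0 L = [:: nseq L 0%N].
Proof. by elim: L => [|L IHL] //; rewrite boxS IHL. Qed.

Lemma pieri_base y L nu N : size nu = L ->
  \sum_(la <- box N L.+1) rows q s [::] la * rowV q s y la (rcons nu 0%N)
  = rows q s [::] (rcons nu 0%N).
Proof.
move=> sz; rewrite (@big_box_supp _ _ N 0) => [|la sz' /eqP].
  rewrite box0 big_seq1 !rows_nil all_nseq eqxx orbT mul1r.
  have [/all_eq0P nu0|/negP nu_neq0] := boolP (all _ (rcons nu 0%N)).
    have -> : rcons nu 0%N = nseq L.+1 0%N.
      rewrite -sz -(size_rcons nu 0%N); apply/all_pred1P/allP => a.
      by move=> /(nthP 0%N)[i _ <-]; apply/eqP.
    by rewrite rowV_nseq0.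
  apply/eqP; apply: contra_notT nu_neq0 => /rowV_neq0[_ h].
  apply/all_eq0P => i; have [+ _] := h i.
  by rewrite nth_nseq if_same leqn0 => /eqP.
rewrite mulf_eq0 negb_or => /andP[/(rows_nil_neq0 sz')-> _].
by rewrite !all_nseq !orbT.
Qed.

Lemma rcons_take_last (mu : seq nat) L : size mu = L.+1 -> nth 0%N mu L = 0%N ->
  mu = rcons (take L mu) 0%N.
Proof.
by move=> sz mu0; rewrite -mu0 -take_nth ?sz // -sz take_size.
Qed.

Section PieriStep.
Variables (L : nat) (x y : C) (nu : seq nat).
Let nu0 := rcons nu 0%N.
Let B := sumn nu0.
Let c N mu := \sum_(la <- box N L.+1) rowU q s x la mu * rowV q s y la nu0.
Let r mu := \sum_(ka <- box B L.+1) rowU q s x nu0 ka * rowV q s y mu ka.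

Let nu0_le i : (nth 0%N nu0 i <= B)%N.
Proof. by apply/all_leP/all_le_sumn. Qed.

(** Since mu_(i+1) <= la_(i+1) <= nu_i, the tail of [mu] lives in a box independent of [N]; the
    truncation affects its head [h] only. *)
Lemma sum_rowUV_exchange (f : seq nat -> C) N :
  \sum_(la <- box N L.+1)
     (\sum_(mu <- box N (size la)) f mu * rowU q s x la mu) * rowV q s y la nu0
  = \sum_(0 <= h < N.+1) \sum_(t <- box B L) f (h :: t) * c N (h :: t).
Proof.
transitivity (\sum_(la <- box N L.+1) \sum_(0 <= h < N.+1)
   \sum_(t <- box B L) f (h :: t) * (rowU q s x la (h :: t) * rowV q s y la nu0)).
  rewrite big_seq [RHS]big_seq; apply: eq_bigr => la.
  rewrite mem_box => /andP[/eqP-> /all_leP laN].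
  rewrite big_boxS mulr_suml; apply: eq_bigr => h _; rewrite mulr_suml.
  under eq_bigr do rewrite -mulrA.
  apply: big_box_supp => t szt /eqP; rewrite !mulf_eq0 !negb_or.
  move=> /andP[_ /andP[/rowU_neq0[_ lamu] /rowV_neq0[_ lanu]]].
  split; apply/all_leP => i; have [/= le _] := lamu i.+1; apply: leq_trans le _.
    exact: laN.
  by have [_ le] := lanu i; apply: leq_trans le _.
rewrite exchange_big; apply: eq_bigr => h _; rewrite exchange_big.
by apply: eq_bigr => t _; rewrite /c mulr_sumr.
Qed.

Lemma sum_rowVU_exchange (f : seq nat -> C) N :
  \sum_(0 <= h < N.+1) \sum_(t <- box B L) f (h :: t) * r (h :: t)
  = \sum_(ka <- box B L.+1) rowU q s x nu0 ka *
      \sum_(mu <- box N L.+1) f mu * rowV q s y mu ka.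
Proof.
transitivity (\sum_(0 <= h < N.+1) \sum_(t <- box B L)
   \sum_(ka <- box B L.+1) rowU q s x nu0 ka *
     (f (h :: t) * rowV q s y (h :: t) ka)).
  apply: eq_bigr => h _; apply: eq_bigr => t _; rewrite /r mulr_sumr.
  by apply: eq_bigr => ka _; rewrite mulrCA.
under eq_bigr do rewrite exchange_big.
rewrite exchange_big; apply: eq_bigr => ka _.
rewrite big_boxS mulr_sumr; apply: eq_big_nat => h /andP[_ lehN].
rewrite mulr_sumr; apply: big_box_supp => t szt /eqP.
rewrite !mulf_eq0 !negb_or => /andP[/rowU_neq0[_ nuka]].
move=> /andP[_ /rowV_neq0[_ muka]]; split; apply/all_leP => i.
  have [_ /= le] := muka i; apply: leq_trans le _.
  by have [le _] := nuka i; apply: leq_trans le _.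
by apply: leq_trans (interlace_head muka i.+1) _; rewrite -ltnS.
Qed.

End PieriStep.

Lemma pieri_step L x y (xs : seq C) (P P' : C) nu :
  nrm x < 1 -> nrm y < 1 -> (forall z, z \in xs -> nrm z < 1) ->
  (size xs <= L)%N ->
  (forall mu nu, size mu = size nu ->
    (fun N => \sum_(la <- box N (size mu).+1) rowU q s x la (rcons mu 0%N) *
       rowV q s y la (rcons nu 0%N)) @ \oo -->
    (P * (gaps q s (rcons nu 0%N) * Ktop q s x y mu nu) : C)) ->
  (forall nu, size nu = L ->
    (fun N => \sum_(la <- box N L.+1) rows q s xs la
      * rowV q s y la (rcons nu 0%N)) @ \oo -->
    (P' * rows q s xs (rcons nu 0%N) : C)) ->
  size nu = L ->
  (fun N => \sum_(la <- box N L.+1) rows q s (x :: xs) la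
      * rowV q s y la (rcons nu 0%N)) @ \oo -->
    (P * P' * rows q s (x :: xs) (rcons nu 0%N) : C).
Proof.
move=> x1 y1 xs1 szxs hP hP' sz; set nu0 := rcons nu 0%N; set B := sumn nu0.
pose c N mu := \sum_(la <- box N L.+1) rowU q s x la mu * rowV q s y la nu0.
pose r mu := \sum_(ka <- box B L.+1) rowU q s x nu0 ka * rowV q s y mu ka.
pose d t N h := if (size t == L) && (nth 0%N (h :: t) L == 0%N) then c N (h :: t) - P * r (h :: t)
  else 0.
have sz0 : size nu0 = L.+1 by rewrite size_rcons sz.
have nth0 : nth 0%N nu0 L = 0%N by rewrite nth_rcons sz ltnn eqxx.
have cvg_c mu : size mu = L.+1 -> nth 0%N mu L = 0%N ->
    (fun N => c N mu) @ \oo --> (P * r mu : C).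
  move=> szmu mu0; have muE := rcons_take_last szmu mu0.
  have szt : size (take L mu) = L by rewrite size_take szmu ltnSn.
  have szn : size (take L mu) = size nu by rewrite szt sz.
  have rE : r mu = gaps q s nu0 * Ktop q s x y (take L mu) nu.
    rewrite -(@sum_box_rowVU _ q s x y B) ?szt -?muE //.
    by rewrite /B /nu0; case: (nu) => //= a l; apply: leq_addr.
  have := hP _ _ szn; rewrite szt -muE -/nu0 -rE; exact.
have c_bounded : exists B' : R, forall mu N, size mu = L.+1 ->
    nth 0%N mu L = 0%N -> nrm (c N mu) <= B'.
  have [B' hB'] := rowUV_bounded q1 s1 x1 y1 nu; exists B' => mu N szmu mu0.
  have muE := rcons_take_last szmu mu0.
  have szt : size (take L mu) = L by rewrite size_take szmu ltnSn.
  by have := hB' N (take L mu); rewrite szt sz -muE; apply.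
have [B' hB'] := c_bounded.
have d_bounded t N h : nrm (d t N h) <= B' + B'.
  have B0 : 0 <= B'.
    by apply: le_trans (hB' (nseq L.+1 0%N) 0%N _ _);
      rewrite ?nrm_ge0 ?size_nseq ?nth_nseq ?if_same.
  rewrite /d; case: andP => [[/eqP szt /eqP mu0]|_]; last by rewrite nrm0 addr_ge0.
  have szht : size (h :: t) = L.+1 by rewrite /= szt.
  rewrite (le_trans (ler_nrmD _ _)) // nrmN lerD ?hB' //.
  by apply: lim_nrm_le (cvg_c _ szht mu0) _ => n; apply: hB'.
have d_cvg t h : (fun N => d t N h) @ \oo --> (0 : C).
  rewrite /d; case: andP => [[/eqP szt /eqP mu0]|_]; last exact: cvg_cst.
  have szht : size (h :: t) = L.+1 by rewrite /= szt.
  rewrite -[X in _ --> X](subrr (P * r (h :: t))).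
  by apply: cvgB (cvg_cst _); apply: cvg_c.
have sumE N : \sum_(la <- box N L.+1) rows q s (x :: xs) la * rowV q s y la nu0
  = \sum_(t <- box B L) (\sum_(0 <= h < N.+1) rows q s xs (h :: t) * d t N h)
    + P * \sum_(ka <- box B L.+1) rowU q s x nu0 ka *
        \sum_(mu <- box N L.+1) rows q s xs mu * rowV q s y mu ka.
  rewrite -sum_rowVU_exchange -/nu0 -/B.
  transitivity (\sum_(0 <= h < N.+1) \sum_(t <- box B L)
     rows q s xs (h :: t) * c N (h :: t)).
    rewrite -sum_rowUV_exchange big_seq [RHS]big_seq; apply: eq_bigr => la.
    by rewrite mem_box => /andP[_ laN]; rewrite (rows_consE _ _ _ _ laN).
  transitivity (\sum_(0 <= h < N.+1) (\sum_(t <- box B L)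
     rows q s xs (h :: t) * d t N h
     + P * \sum_(t <- box B L) rows q s xs (h :: t) * r (h :: t))).
    apply: eq_bigr => h _; rewrite mulr_sumr -big_split.
    rewrite big_seq [RHS]big_seq; apply: eq_bigr => t; rewrite mem_box.
    case/andP => /eqP szt _; rewrite /d szt.
    change (rows q s xs (h :: t) * c N (h :: t) = rows q s xs (h :: t) *
      (if (L == L) && (nth 0%N (h :: t) L == 0%N)
       then c N (h :: t) - P * r (h :: t) else 0)
      + P * (rows q s xs (h :: t) * r (h :: t))).
    have [->|/rows_neq0 xs0] := eqVneq (rows q s xs (h :: t)) 0.
      by rewrite !mul0r mulr0 addr0.
    by rewrite xs0 // !eqxx andbT mulrBr (mulrCA P) subrK.
  rewrite big_split; congr (_ + _); first by rewrite exchange_big.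
  by rewrite mulr_sumr.
rewrite (funext sumE).
rewrite (_ : P * P' * _ = 0 + P * (P' * rows q s (x :: xs) nu0)); last first.
  by rewrite add0r mulrA.
apply: cvgD.
  rewrite [X in _ --> X](_ : _ = \sum_(t <- box B L) 0); last first.
    by rewrite big1.
  apply: cvg_lsum => t; apply: tannery => [||h]; last exact: d_cvg.
    exact: rows_bounded.
  by move=> N h _; apply: d_bounded.
apply: cvgM; first exact: cvg_cst.
have szn0 := sz0; rewrite [rows _ _ _ _]/= -/B sz0 mulr_sumr.
under [X in _ --> X]eq_bigr do rewrite mulrA (mulrC _ (rowU _ _ _ _ _)).
apply: cvg_lsum => ka; have [->|/rowU_neq0[szka nuka]] :=
    eqVneq (rowU q s x nu0 ka) 0.
  by rewrite mul0r; under eq_fun do rewrite mul0r; apply: cvg_cst.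
apply: cvgM; first exact: cvg_cst.
(* The hypothesis on [xs] concerns lists ending in 0; [ka] is one of them because it lies below
   [nu0]. *)
have ka0 : nth 0%N ka L = 0%N.
  by have [le _] := nuka L; rewrite nth0 leqn0 in le; apply/eqP.
have szt : size (take L ka) = L by rewrite size_take -szka sz0 ltnSn.
by rewrite (rcons_take_last _ ka0) -?szka //; apply: hP'.
Qed.

(** [P] is chosen before [nu], so that for a fixed [L] the case of the empty partition determines
    it. *)
Lemma pieri_cvg L y (xs : seq C) : nrm y < 1 ->
  (forall z, z \in xs -> nrm z < 1) -> (size xs <= L)%N ->
  exists P : C, forall nu, size nu = L ->
  (fun N => \sum_(la <- box N L.+1) rows q s xs la
      * rowV q s y la (rcons nu 0%N)) @ \oo -->
    (P * rows q s xs (rcons nu 0%N) : C).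
Proof.
move=> y1; elim: xs => [|x xs IHxs] xs1 szxs.
  exists 1 => nu sz; rewrite mul1r.
  by under eq_fun do rewrite pieri_base //; apply: cvg_cst.
have x1 : nrm x < 1 by apply: xs1; rewrite inE eqxx.
have {}xs1 z : z \in xs -> nrm z < 1 by move=> zxs; apply: xs1; rewrite inE zxs orbT.
have [P' hP'] := IHxs xs1 (ltnW szxs).
have [P hP] := rowUV_cvg q1 s1 x1 y1.
by exists (P * P') => nu sz; apply: pieri_step => //; apply: ltnW.
Qed.

(** Convergence along boxes does not give unordered summability; this bound on the absolute values
    does. For a fixed tail, [rowV] is bounded in the largest part and [rows_bounded] applies. *)
Lemma pieri_abs_bounded L y (xs : seq C) nu : nrm y < 1 ->
  (forall z, z \in xs -> nrm z < 1) -> size nu = L ->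
  exists B : R, forall N, \sum_(la <- box N L.+1)
     nrm (rows q s xs la * rowV q s y la (rcons nu 0%N)) <= B.
Proof.
move=> y1 xs1 sz; set nu0 := rcons nu 0%N; set B := sumn nu0.
pose f t h := rows q s xs (h :: t) * rowV q s y (h :: t) nu0.
have fB t : bounded_nrm_series (f t).
  have [Uy Uy0 hUy] := ext_bounded (bounded_series_bounded (up_bounded_series s q1 y1)).
  have [n [nu1 nuE]] : exists n nu1, nu0 = n :: nu1.
    by rewrite /nu0; case: (nu) => [|n l]; [exists 0%N, [::]|exists n, (rcons l 0%N)].
  pose K := ext (downw q s y) n (head 0%N t) * ext (gapw q s) n (head 0%N nu1)
     * rowV q s y t nu1.
  have UK0 : 0 <= Uy * nrm K by rewrite mulr_ge0 ?nrm_ge0.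
  apply: (bounded_nrm_series_dom UK0 _ (rows_bounded t xs1)) => h.
  have -> : f t h = ext (upw q s y) h n * K * rows q s xs (h :: t).
    by rewrite /f nuE /K /=; ring.
  by rewrite 2!nrmM ler_wpM2r ?nrm_ge0 // ler_wpM2r ?nrm_ge0.
pose g t := sval (cid (fB t)).
exists (\sum_(t <- box B L) g t) => N.
apply: (@le_trans _ _ (\sum_(t <- box B L) \sum_(0 <= h < N.+1) nrm (f t h))).
  rewrite exchange_big big_boxS le_eqVlt; apply/orP; left; apply/eqP.
  apply: eq_big_nat => h /andP[_ lthN]; apply: big_box_supp => t szt ft0.
  have : rowV q s y (h :: t) nu0 != 0.
    by apply: contra_notN ft0 => /eqP ->; rewrite mulr0 nrm0.
  move=> /rowV_neq0[_ hnu]; split; apply/all_leP => i.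
    by apply: leq_trans (interlace_head hnu i.+1) _; rewrite -ltnS.
  have [_ /= le] := hnu i; apply: leq_trans le _.
  exact/all_leP/all_le_sumn.
by apply: ler_sum => t _; apply: (svalP (cid (fB t))).
Qed.

End Pieri.

(** * Unordered sums over partitions *)

Definition pad L (la : seq nat) : seq nat := la ++ nseq (L - size la) 0%N.

Lemma size_pad L la : (size la <= L)%N -> size (pad L la) = L.
Proof. by move=> le; rewrite size_cat size_nseq subnKC. Qed.

Lemma nth_pad L la i : nth 0%N (pad L la) i = nth 0%N la i.
Proof.
rewrite nth_cat nth_nseq if_same; case: ltnP => // le.
by rewrite nth_default.
Qed.

Lemma filter_pad L (la : int_partition) :
  [seq a <- pad L la | a != 0%N] = la.
Proof.
case: la => la /= /andP[_ la0]; rewrite filter_cat.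
rewrite (_ : [seq a <- nseq _ _ | _] = [::]); last first.
  by elim: (L - size la)%N.
rewrite cats0; apply/all_filterP/allP => a ala.
by apply: contraNneq la0 => <-.
Qed.

Lemma pad_filter la : sorted geq la ->
  pad (size la) [seq a <- la | a != 0%N] = la.
Proof.
rewrite /pad; elim: la => // a la IHla /=.
rewrite (path_sortedE (rev_trans leq_trans)) => /andP[/allP lea srt].
have [a0|a0] := eqVneq a 0%N; last first.
  by rewrite /= subSS IHla.
have la0 : la = nseq (size la) 0%N.
  apply/all_pred1P/allP => b /lea; rewrite a0 /= => b0.
  by apply/eqP; move: b0; case: b.
rewrite /= (_ : [seq b <- la | b != 0%N] = [::]); last first.
  by rewrite la0; elim: (size la).
by rewrite /= a0 -la0.
Qed.

Lemma is_part_filter la : sorted geq la -> is_part [seq a <- la | a != 0%N].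
Proof.
move=> srt; rewrite /is_part sorted_filter //=; last exact: (rev_trans leq_trans).
by rewrite mem_filter eqxx.
Qed.

Lemma big_box_split (V : nmodType) (F : seq nat -> V) N M L : (N <= M)%N ->
  \sum_(la <- box M L) F la = \sum_(la <- box N L) F la
    + \sum_(la <- box M L | ~~ all (leq^~ N) la) F la.
Proof.
move=> leNM; rewrite (bigID (all (leq^~ N))) /=; congr (_ + _).
rewrite big_mkcond (@big_box_sub _ _ M N) //=; last first.
  by move=> la _ /negbTE ->.
rewrite big_seq [RHS]big_seq; apply: eq_bigr => la.
by rewrite mem_box => /andP[_ ->].
Qed.

Section HasSum.
Variable R : realType.
Local Notation C := (R[i] : numFieldType).
Local Notation nrm := (@Normc.normc R).

(** A finite set containing all partitions of a large box differs from that box only by terms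
    outside it, and these are small in absolute sum. Sortedness on the support makes every nonzero
    term come from a partition. *)
Lemma has_sum_box (g : seq nat -> C) L (S : C) (B : R) :
  (forall la, size la = L -> g la != 0 -> sorted geq la) ->
  (fun N => \sum_(la <- box N L) g la) @ \oo --> S ->
  (forall N, \sum_(la <- box N L) nrm (g la) <= B) ->
  has_sum (fun la : int_partition =>
    if (size la <= L)%N then g (pad L la) else 0) S.
Proof.
move=> g_sorted gS gB; set f := fun la : int_partition => _.
have FF : Filter (@totally int_partition) by apply: totally_filter.
apply/cvgrPdist_lt => eps; rewrite ltcE /= => /andP[/eqP eps_im eps_gt0].
pose e := complex.Re eps.
have e2 : 0 < e / 2 by rewrite divr_gt0.
have [N1 HN1] := (climP _ _).1 gS _ e2.
pose b N := \sum_(la <- box N L) nrm (g la).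
have bS M N : (N <= M)%N ->
    b M = b N + \sum_(la <- box M L | ~~ all (leq^~ N) la) nrm (g la).
  exact: big_box_split.
have b_ndec : {homo b : n m / (n <= m)%N >-> n <= m}.
  move=> n m /bS ->; rewrite lerDl; apply: sumr_ge0 => la _.
  exact: nrm_ge0.
have b_ub : has_ubound (range b) by exists B => _ [n _ <-]; apply: gB.
have /cvgrPdist_lt b_cvg := nondecreasing_is_cvgn b_ndec b_ub.
have e4 : 0 < e / 2 / 2 by rewrite divr_gt0.
have [N2 _ HN2] := b_cvg _ e4.
pose N := maxn N1 N2.
have tail M : (N <= M)%N ->
    \sum_(la <- box M L | ~~ all (leq^~ N) la) nrm (g la) < e / 2.
  move=> leNM.
  have := HN2 N (leq_maxr _ _); have := HN2 M (leq_trans (leq_maxr _ _) leNM).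
  by rewrite /= (bS M N leNM) !ltr_norml => h1 h2; move: h1 h2; lra.
(* These are the partitions whose padding lies in the box: zeros are deleted and [insub] drops
   unsorted lists. *)
pose A0 : {fset int_partition} := seq_fset tt (pmap insub
   [seq [seq a <- la | a != 0%N] | la <- box N L]).
exists A0 => // A sA0A.
change (`|S - partial_sum f A| < eps).
rewrite normr_nrm ltcE; apply/andP; split; first exact/eqP.
change (nrm (S - partial_sum f A) < e).
(* The box of bound [M] contains the padding of every member of [A] with at most [L] parts. *)
pose M := maxn N (\max_(p <- enum_fset A) sumn p).
have leNM : (N <= M)%N by apply: leq_maxl.
pose sA := [seq pad L p | p : int_partition <- enum_fset A & (size p <= L)%N].
have sA_uniq : uniq sA.
  rewrite map_inj_in_uniq ?filter_uniq ?fset_uniq // => p p' _ _ pp'.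
  by apply: val_inj; rewrite /= -(filter_pad L p) pp' filter_pad.
have sumA : partial_sum f A = \sum_(la <- box M L | la \in sA) g la.
  rewrite /partial_sum -(big_seq_fsetE _ _ xpredT f) /= /f -big_mkcond /=.
  rewrite -big_filter -(big_map (fun p : int_partition => pad L p) xpredT g) -[RHS]big_filter.
  apply: perm_big; apply: uniq_perm => //; first by rewrite filter_uniq ?box_uniq.
  move=> la; rewrite mem_filter; case: (boolP (la \in _)) => //= /mapP[p].
  rewrite mem_filter => /andP[szp pA] ->; rewrite mem_box size_pad // eqxx /=.
  apply/esym/all_leP => i; rewrite nth_pad.
  apply: leq_trans (_ : sumn p <= _)%N; first exact/all_leP/all_le_sumn.
  by rewrite leq_max; apply/orP; right; apply: leq_bigmax_seq.
have in_sA la : la \in box N L -> g la != 0 -> la \in sA.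
  rewrite mem_box => /andP[/eqP szla laN] /(g_sorted _ szla) srt.
  apply/mapP; exists (IntPartition (is_part_filter srt)); last first.
    by rewrite /= -szla pad_filter.
  rewrite mem_filter /= -{1}szla size_filter count_size /=.
  apply: (fsubsetP sA0A); rewrite seq_fsetE mem_pmap; apply/mapP.
  exists [seq a <- la | a != 0%N].
    by apply/mapP; exists la => //; rewrite mem_box szla eqxx.
  by rewrite insubT ?is_part_filter // => h; congr Some; apply: val_inj.
have -> : S - partial_sum f A = (S - \sum_(la <- box N L) g la)
   - \sum_(la <- box M L | (la \in sA) && ~~ all (leq^~ N) la) g la.
  rewrite sumA (bigID (all (leq^~ N))) /= opprD addrA; congr (_ - _ - _).
  rewrite big_mkcond (@big_box_sub _ _ M N) //=; last first.
    by move=> la _ /negbTE ->; rewrite andbF.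
  rewrite big_seq [RHS]big_seq; apply: eq_bigr => la laN.
  have [->|g0] := eqVneq (g la) 0; first by rewrite if_same.
  by rewrite in_sA //=; move: laN; rewrite mem_box => /andP[_ ->].
apply: (le_lt_trans (ler_nrmD _ _)); rewrite nrmN.
have h1 := HN1 N (leq_maxl _ _); have h2 := tail M leNM.
have h3 : nrm (\sum_(la <- box M L | (la \in sA) && ~~ all (leq^~ N) la) g la)
    <= \sum_(la <- box M L | ~~ all (leq^~ N) la) nrm (g la).
  apply: (le_trans (ler_nrm_sum _ _ _)).
  rewrite [leLHS]big_mkcond [leRHS]big_mkcond; apply: ler_sum => la _.
  by case: (la \in sA) => //=; case: ifP => // _; apply: nrm_ge0.
by rewrite nrmB; move: h1 h2 h3; lra.
Qed.

End HasSum.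

(** * Path configurations as chains of partitions *)

Lemma eq_of_diff (f g : nat -> nat) M :
  (forall c, (f c.+1 <= f c)%N) -> (forall c, (g c.+1 <= g c)%N) ->
  (forall c, f c - f c.+1 = g c - g c.+1)%N ->
  (forall c, (M <= c)%N -> f c = 0%N /\ g c = 0%N) -> f =1 g.
Proof.
move=> fd gd fg fg0 c; have [k] := ubnP (M - c)%N.
elim: k c => // k IHk c ltk; have [le|lt] := leqP M c.
  by have [-> ->] := fg0 c le.
have := IHk c.+1 ltac:(lia); have := fg c; have := fd c; have := gd c; lia.
Qed.

Fixpoint chains (T : Type) (s : seq T) n : seq (seq T) :=
  if n is n'.+1 then [seq rcons c k | c <- chains s n', k <- s] else [:: [::]].

Lemma mem_chains (T : eqType) (s : seq T) n c :
  (c \in chains s n) = (size c == n) && all (mem s) c.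
Proof.
elim: n c => [|n IHn] c; first by case: c.
case/lastP: c => [|c k].
  by apply/negbTE/negP => /allpairsP[[c k] [_ _ /(congr1 size)]]; rewrite size_rcons.
rewrite size_rcons eqSS all_rcons /=; apply/allpairsP/idP.
  move=> [[c' k'] /= [c's k's /eqP]]; rewrite eqseq_rcons.
  by move=> /andP[/eqP-> /eqP->]; move: c's; rewrite IHn k's => /andP[-> ->].
by move=> /and3P[sz ks cs]; exists (c, k); split=> //; rewrite IHn sz.
Qed.

Lemma chains_uniq (T : eqType) (s : seq T) n : uniq s -> uniq (chains s n).
Proof.
move=> us; elim: n => //= n IHn; rewrite allpairs_uniq //.
by move=> [c k] [c' k'] _ _ /= /eqP; rewrite eqseq_rcons => /andP[/eqP-> /eqP->].
Qed.

Lemma big_chainsS (V : nmodType) (T : Type) (s : seq T) n (P : pred (seq T))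
    (F : seq T -> V) :
  \sum_(ch <- chains s n.+1 | P ch) F ch
  = \sum_(c <- chains s n) \sum_(k <- s | P (rcons c k)) F (rcons c k).
Proof.
rewrite big_mkcond -[chains _ _]/[seq rcons c k | c <- chains s n, k <- s].
by rewrite big_allpairs_dep; apply: eq_bigr => c _; rewrite -big_mkcond.
Qed.

(** * Partition functions as sums over chains *)

Section Reduction.
Variables (C : numFieldType) (q s : C).
Implicit Types (x : C) (xs zs : seq C) (la mu : seq nat).

(* As in [rows], the last variable comes first. *)
Fixpoint rows_from mu xs la : C :=
  if xs is x :: xs' then
    \sum_(ka <- box (sumn la) (size la)) rows_from mu xs' ka * rowU q s x la ka
  else (la == mu)%:R.

Lemma rows_from_nseq0 xs la : rows_from (nseq (size la) 0%N) xs la = rows q s xs la.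
Proof.
elim: xs la => [|x xs IHxs] la /=.
  congr (_%:R); congr nat_of_bool; apply/eqP/all_eq0P => [-> i|la0].
    by rewrite nth_nseq if_same.
  by apply: (@eq_from_nth _ 0%N) => [|i _]; rewrite ?size_nseq // la0 nth_nseq if_same.
rewrite big_seq [RHS]big_seq; apply: eq_bigr => ka.
by rewrite mem_box => /andP[/eqP szka _]; rewrite -IHxs szka.
Qed.

Lemma rows_from_cons_box mu x xs la N : all (leq^~ N) la ->
  rows_from mu (x :: xs) la
  = \sum_(ka <- box N (size la)) rows_from mu xs ka * rowU q s x la ka.
Proof.
move=> /all_leP laN; apply: big_box_supp => ka _ /eqP.
rewrite mulf_eq0 negb_or => /andP[_ /rowU_neq0[_ laka]].
have /all_leP lasum := all_le_sumn la.
split; apply/all_leP => i; have [le _] := laka i; apply: leq_trans le _.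
  exact: lasum.
exact: laN.
Qed.

Lemma rows_from1 mu x la : rows_from mu [:: x] la = rowU q s x la mu.
Proof.
have [mub|muNb] := boolP (mu \in box (sumn la) (size la)).
  rewrite /= (bigD1_seq mu) ?box_uniq //= eqxx mul1r big1 ?addr0 // => ka.
  by move=> /negbTE ->; rewrite mul0r.
rewrite /= big_seq big1 => [|ka kab]; last first.
  by case: eqP => [kamu|_]; [move: muNb; rewrite -kamu kab|rewrite mul0r].
apply/esym/eqP; apply: contraNT muNb => /rowU_neq0[sz lamu].
rewrite mem_box sz eqxx; apply/all_leP => i; have [le _] := lamu i.
by apply: leq_trans le _; apply/all_leP/all_le_sumn.
Qed.

(* Here, unlike in [rows_from], the first variable comes first. *)
Definition chain_weight zs (ch : seq (seq nat)) : C :=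
  \prod_(r < size zs) rowU q s zs`_r (nth [::] ch r.+1) (nth [::] ch r).

(** Removing the last entry of a chain removes the top row. [rows_from] lists the top variable
    first, hence [rev]. *)
Lemma sum_chains N L mu zs la : la \in box N L ->
  \sum_(ch <- chains (box N L) (size zs).+1 |
         (nth [::] ch 0 == mu) && (nth [::] ch (size zs) == la))
     chain_weight zs ch
  = rows_from mu (rev zs) la.
Proof.
elim/last_ind: zs la => [|zs z IHzs] la lab.
  rewrite (eq_bigr (fun=> 1)) => [|ch _]; last by rewrite /chain_weight big_ord0.
  rewrite [RHS]/= big_chainsS big_seq1 big_mkcond (bigD1_seq la) ?box_uniq //=.
  rewrite eqxx andbT big1 ?addr0 => [|ka /negbTE ->]; last by rewrite andbF.
  by case: eqP.
rewrite rev_rcons (@rows_from_cons_box _ _ _ _ N); last first.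
  by move: lab; rewrite mem_box => /andP[].
have -> : size la = L by move: lab; rewrite mem_box => /andP[/eqP].
rewrite size_rcons; set n := size zs.
rewrite big_chainsS; under eq_bigr do rewrite big_mkcond.
transitivity (\sum_(c <- chains (box N L) n.+1 | nth [::] c 0 == mu)
   chain_weight zs c * rowU q s z la (nth [::] c n)).
  rewrite [RHS]big_mkcond big_seq [RHS]big_seq; apply: eq_bigr => c.
  rewrite mem_chains => /andP[/eqP szc _].
  have e1 : (rcons zs z)`_n = z by rewrite nth_rcons ltnn eqxx.
  have e2 ka : nth [::] (rcons c ka) n.+1 = ka by rewrite nth_rcons szc ltnn eqxx.
  have e3 ka r : (r < n.+1)%N -> nth [::] (rcons c ka) r = nth [::] c r.
    by rewrite nth_rcons szc => ->.
  rewrite (bigD1_seq la) ?box_uniq //= big1 => [|ka /negbTE kala]; last first.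
    by rewrite e2 kala andbF.
  rewrite addr0 e2 e3 // eqxx andbT; case: ifP => // _.
  rewrite /chain_weight size_rcons big_ord_recr /= -/n e1 e2 e3 //.
  congr (_ * _); apply: eq_bigr => r _; rewrite !e3 ?ltnS //; last exact: ltnW.
  by rewrite nth_rcons ltn_ord.
transitivity (\sum_(ka <- box N L) (\sum_(c <- chains (box N L) n.+1 |
   (nth [::] c 0 == mu) && (nth [::] c n == ka)) chain_weight zs c)
   * rowU q s z la ka); last first.
  rewrite big_seq [RHS]big_seq; apply: eq_bigr => ka kab.
  by rewrite IHzs.
under [RHS]eq_bigr do rewrite mulr_suml.
rewrite (exchange_big_dep (fun c => nth [::] c 0 == mu)); last first.
  by move=> ka c _ /andP[].
rewrite big_seq_cond [RHS]big_seq_cond; apply: eq_bigr => c /andP[cch c0].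
rewrite c0 /= (big_rem (nth [::] c n)) /=; last first.
  move: cch; rewrite mem_chains => /andP[/eqP szc /allP cb].
  by apply: cb; rewrite mem_nth // szc.
rewrite eqxx big_seq_cond big1 ?addr0 // => ka.
by rewrite mem_rem_uniq ?box_uniq // inE eq_sym => /andP[/andP[/negbTE->]].
Qed.

(** With horizontal edges la_c - mu_c and vertical edges given by multiplicities, path conservation
    is automatic, and i - l becomes mu_c - la_(c+1), so the condition i >= l is half of the
    interlacing. *)
Lemma weight_interlace x la mu c : interlace la mu ->
  weight q s x (mult mu c) (nth 0%N la c - nth 0%N mu c) (mult la c)
    (nth 0%N la c.+1 - nth 0%N mu c.+1)
  = ext (upw q s x) (nth 0%N la c.+1) (nth 0%N mu c.+1)
    * ext (downw q s x) (nth 0%N mu c) (nth 0%N la c.+1)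
    * ext (gapw q s) (nth 0%N la c) (nth 0%N la c.+1).
Proof.
move=> lamu; have [h1 h2] := lamu c; have [h3 h4] := lamu c.+1.
rewrite /weight /mult /ext h2 h3 (leq_trans h2 h1).
rewrite (_ : _ && _); last by apply/andP; split; [apply/eqP|]; lia.
rewrite (_ : nth 0 mu c - nth 0 mu c.+1 - (nth 0 la c.+1 - nth 0 mu c.+1)
  = nth 0 mu c - nth 0 la c.+1)%N; last by lia.
rewrite /upw /downw /gapw !invfM; ring.
Qed.

Lemma rowU_prod x la mu M : size la = size mu -> (size la <= M)%N ->
  rowU q s x la mu
  = ext (upw q s x) (nth 0%N la 0) (nth 0%N mu 0) * \prod_(c < M)
   (ext (upw q s x) (nth 0%N la c.+1) (nth 0%N mu c.+1)
    * ext (downw q s x) (nth 0%N mu c) (nth 0%N la c.+1)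
    * ext (gapw q s) (nth 0%N la c) (nth 0%N la c.+1)).
Proof.
elim: la mu M => [|l la IHla] [|m mu] M //.
  move=> _ _; rewrite ![nth _ [::] 0]/= ext_id up0 mul1r big1 // => c _.
  by rewrite !nth_nil !ext_id down0 gap0 !mulr1.
move=> [sz]; case: M => // M leM; rewrite big_ord_recl /= (IHla mu M) // !nth0.
ring.
Qed.

(* [ch] lists the partitions below, between and above the rows, from bottom to
   top. *)
Definition chain_config n (ch : seq (seq nat)) : config n :=
  ((fun (r : 'I_n) c => nth 0 (nth [::] ch r.+1) c - nth 0 (nth [::] ch r) c)%N,
   (fun (r : 'I_n.+1) c => mult (nth [::] ch r) c)).

Lemma row_weight_chain n (x : 'I_n -> C) L ch (r : 'I_n) :
  size (nth [::] ch r) = L -> size (nth [::] ch r.+1) = L ->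
  interlace (nth [::] ch r.+1) (nth [::] ch r) ->
  row_weight q s x (chain_config n ch) r
  = rowU q s (x r) (nth [::] ch r.+1) (nth [::] ch r).
Proof.
move=> sz sz' lamu; rewrite /row_weight /=.
rewrite (rowU_prod (x r) (M := L)) ?sz ?sz' //.
have [h _] := lamu 0%N.
congr (_ * _); first by rewrite /ext h.
apply: lim_near_cst; first exact: norm_hausdorff.
exists L => // N /= leLN.
transitivity (\prod_(0 <= c < N)
   (ext (upw q s (x r)) (nth 0%N (nth [::] ch r.+1) c.+1) (nth 0%N (nth [::] ch r) c.+1)
    * ext (downw q s (x r)) (nth 0%N (nth [::] ch r) c) (nth 0%N (nth [::] ch r.+1) c.+1)
    * ext (gapw q s) (nth 0%N (nth [::] ch r.+1) c) (nth 0%N (nth [::] ch r.+1) c.+1))).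
  rewrite big_mkord; apply: eq_bigr => c _.
  by rewrite -weight_interlace.
rewrite (@big_cat_nat _ _ _ L) //= [X in _ * X]big_nat_cond.
rewrite [X in _ * X]big1 ?mulr1 ?big_mkord // => c /andP[/andP[leLc _] _].
rewrite !(nth_default 0%N (s := nth [::] ch r)) ?sz ?leqW //.
rewrite !(nth_default 0%N (s := nth [::] ch r.+1)) ?sz' ?leqW //.
by rewrite !ext_id up0 down0 gap0 !mulr1.
Qed.

(** One vanishing vertex weight annihilates all later partial products, hence their limit. *)
Lemma row_weight_neq0 n (x : 'I_n -> C) (hv : config n) (r : 'I_n) c :
  row_weight q s x hv r != 0 ->
  (hv.2 (widen_ord (leqnSn n) r) c + hv.1 r c
    = hv.2 (lift ord0 r) c + hv.1 r c.+1)%N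
  /\ (hv.1 r c.+1 <= hv.2 (widen_ord (leqnSn n) r) c)%N.
Proof.
rewrite mulf_eq0 negb_or => /andP[_].
apply: contraNP => /not_andP h; apply/eqP; apply: lim_near_cst.
  exact: norm_hausdorff.
exists c.+1 => // N /= ltcN; rewrite (bigD1 (Ordinal ltcN)) //=.
rewrite /weight ifF ?mul0r //; apply/negbTE/andP => -[/eqP h1 h2].
by case: h.
Qed.

Lemma sorted_geq_nth la c : sorted geq la -> (nth 0 la c.+1 <= nth 0 la c)%N.
Proof.
move=> srt; have [lt|le] := ltnP c.+1 (size la); last by rewrite nth_default.
by apply: (sortedP 0%N srt).
Qed.

Section Configurations.
Variables (n : nat) (x : 'I_n -> C) (la mu : seq nat) (L : nat).
Hypotheses (la_sorted : sorted geq la) (mu_sorted : sorted geq mu).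
Hypotheses (la_le : (size la <= L)%N) (mu_le : (size mu <= L)%N).
Let N := sumn la.
Let zs := [seq x i | i <- enum 'I_n].

(** A nonzero weight forces interlacing, so that the truncated subtractions in [chain_config] lose
    nothing and [chain_config] is injective on these chains. *)
Let good ch := [&& ch \in chains (box N L) n.+1, nth [::] ch 0 == pad L mu,
  nth [::] ch n == pad L la & chain_weight zs ch != 0].

Let size_zs : size zs = n. Proof. by rewrite size_map size_enum_ord. Qed.

Lemma chain_weightE ch : chain_weight zs ch
  = \prod_(r < n) rowU q s (x r) (nth [::] ch r.+1) (nth [::] ch r).
Proof.
rewrite /chain_weight -(big_mkord xpredT (fun r => rowU q s zs`_r
  (nth [::] ch r.+1) (nth [::] ch r))) size_zs big_mkord.
apply: eq_bigr => r _; congr rowU; rewrite (nth_map r) ?size_enum_ord //.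
by rewrite nth_ord_enum.
Qed.

Lemma good_size ch r : good ch -> (r <= n)%N -> size (nth [::] ch r) = L.
Proof.
case/and4P; rewrite mem_chains => /andP[/eqP sz /allP chb] _ _ _ len.
have /chb /= : nth [::] ch r \in ch by rewrite mem_nth // sz.
by rewrite mem_box => /andP[/eqP].
Qed.

Lemma good_interlace ch r : good ch -> (r < n)%N ->
  interlace (nth [::] ch r.+1) (nth [::] ch r).
Proof.
case/and4P => _ _ _; rewrite chain_weightE => /prodf_neq0 h ltr.
by have [_] := rowU_neq0 (h (Ordinal ltr) isT).
Qed.

Lemma good_row_weights ch : good ch ->
  \prod_(r < n) row_weight q s x (chain_config n ch) r = chain_weight zs ch.
Proof.
move=> gch; rewrite chain_weightE; apply: eq_bigr => r _.
apply: (row_weight_chain x (L := L)); last exact: good_interlace.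
  by apply: good_size => //; apply: ltnW.
exact: good_size.
Qed.

Lemma good_admissible ch : good ch -> @admissible n la mu (chain_config n ch).
Proof.
move=> gch; have /and4P[_ /eqP ch0 /eqP chn _] := gch; split=> [r|c|c] /=.
- exists L => // c /= leLc.
  have s1 := good_size gch (ltn_ord r); have s2 := good_size gch (ltnW (ltn_ord r)).
  by rewrite !(nth_default 0%N) ?s1 ?s2.
- by rewrite ch0 /mult !nth_pad.
- by rewrite chn /mult !nth_pad.
Qed.

Lemma good_inj : set_inj [set ch | good ch] (chain_config n).
Proof.
move=> ch ch'; rewrite !inE /= => gch gch' eq_cfg.
have nthE r : (r <= n)%N -> nth [::] ch r = nth [::] ch' r.
  elim: r => [_|r IHr ltr].
    by case/and4P: gch => _ /eqP-> _ _; case/and4P: gch' => _ /eqP-> _ _.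
  apply: (@eq_from_nth _ 0%N) => [|c _]; first by rewrite !good_size.
  have := congr1 (fun hv : config n => hv.1 (Ordinal ltr) c) eq_cfg => /=.
  have [h _] := good_interlace gch ltr c.
  have [h' _] := good_interlace gch' ltr c.
  move: h h'; rewrite (IHr (ltnW ltr)) => h1 h2 e.
  by rewrite -(subnK h1) e subnK.
have szch c : good c -> size c = n.+1.
  by case/and4P; rewrite mem_chains => /andP[/eqP].
apply: (@eq_from_nth _ [::]) => [|r]; first by rewrite !szch.
by rewrite szch // ltnS => /nthE.
Qed.

(** The partitions are rebuilt from [mu] upwards by adding the horizontal edges of each row.
    Conservation at the vertices identifies vertical edges with differences of parts. *)
Lemma config_good (hv : config n) : @admissible n la mu hv ->
  \prod_(r < n) row_weight q s x hv r != 0 ->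
  exists2 ch, good ch & chain_config n ch = hv.
Proof.
move=> [h0 v0 vn] /prodf_neq0 whv.
have cons (r : 'I_n) c := row_weight_neq0 c (whv r isT).
(* [p r] is the partition below row [r]; [insub] turns the recursion variable into a row index. *)
pose p := fix p r := if r is r'.+1 then
  fun c => (p r' c + (if insub r' is Some i then hv.1 (i : 'I_n) c else 0))%N
  else nth 0%N mu.
have pS (r : 'I_n) c : p r.+1 c = (p r c + hv.1 r c)%N.
  by rewrite /= insubT //= => lt; congr (_ + hv.1 _ _)%N; apply: val_inj.
have pv r : (r <= n)%N -> forall ltr : (r < n.+1)%N, forall c,
    (p r c.+1 <= p r c)%N /\ hv.2 (Ordinal ltr) c = (p r c - p r c.+1)%N.
  elim: r => [_ ltr c|r IHr ltr ltr' c].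
    split; first exact: sorted_geq_nth.
    by rewrite -/(mult mu c) -v0; congr (hv.2 _ _); apply: val_inj.
  have [le1 v1] := IHr (ltnW ltr) (leqW ltr) c.
  have := cons (Ordinal ltr) c; have := pS (Ordinal ltr) c.
  have := pS (Ordinal ltr) c.+1; rewrite -[val _]/r => -> ->.
  rewrite (_ : widen_ord _ _ = Ordinal (leqW ltr)); last exact: val_inj.
  rewrite (_ : lift ord0 _ = Ordinal ltr'); last exact: val_inj.
  by rewrite v1; lia.
have p0 r : (r <= n)%N -> exists M, forall c, (M <= c)%N -> p r c = 0%N.
  elim: r => [_|r IHr ltr].
    by exists (size mu) => c; apply: nth_default.
  have [M hM] := IHr (ltnW ltr); have [M' _ hM'] := h0 (Ordinal ltr).
  exists (maxn M M') => c; rewrite geq_max => /andP[/hM hc /hM' hc'].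
  by rewrite (pS (Ordinal ltr)) hc hc'.
(* The top boundary prescribes only the differences of [p n]; eventual vanishing of both sequences
   does the rest. *)
have pn : p n =1 nth 0%N la.
  have [M hM] := p0 n (leqnn n).
  apply: (@eq_of_diff _ _ (maxn M (size la))) => c.
  - by have [] := pv n (leqnn n) (ltnSn n) c.
  - exact: sorted_geq_nth.
  - have [_ <-] := pv n (leqnn n) (ltnSn n) c.
    by rewrite -/(mult la c) -vn; congr (hv.2 _ _); apply: val_inj.
  - by rewrite geq_max => /andP[/hM-> le]; rewrite nth_default.
have pmono r r' : (r <= r')%N -> forall c, (p r c <= p r' c)%N.
  move=> le c; rewrite -(subnKC le); elim: (r' - r)%N => [|k IHk].
    by rewrite addn0.
  by rewrite addnS; apply: leq_trans IHk _; apply: leq_addr.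
have ple r c : (r <= n)%N -> (p r c <= nth 0%N la c)%N.
  by move=> len; rewrite -pn; apply: pmono.
pose ch := [seq mkseq (p r) L | r <- iota 0 n.+1].
have szch : size ch = n.+1 by rewrite size_map size_iota.
have chE r : (r <= n)%N -> nth [::] ch r = mkseq (p r) L.
  by move=> le; rewrite (nth_map 0%N) ?size_iota // nth_iota.
have nthp r c : (r <= n)%N -> nth 0%N (nth [::] ch r) c = p r c.
  move=> le; rewrite chE //; have [lt|leLc] := ltnP c L; first by rewrite nth_mkseq.
  rewrite nth_default ?size_mkseq //; apply/esym/eqP; rewrite -leqn0.
  by rewrite (leq_trans (ple r c le)) // nth_default // (leq_trans la_le).
have ilace (r : 'I_n) : interlace (nth [::] ch r.+1) (nth [::] ch r).
  move=> c; rewrite !nthp ?(ltnW (ltn_ord r)) //.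
  split; first exact: pmono.
  have [le1 v1] := pv r (ltnW (ltn_ord r)) (leqW (ltn_ord r)) c.
  have [_] := cons r c.
  rewrite (_ : widen_ord _ _ = Ordinal (leqW (ltn_ord r))); last exact: val_inj.
  by rewrite v1 pS; lia.
have cfgE : chain_config n ch = hv.
  have E1 : (chain_config n ch).1 = hv.1.
    apply/funext => r; apply/funext => c.
    rewrite -[LHS]/(nth 0%N (nth [::] ch r.+1) c - nth 0%N (nth [::] ch r) c)%N.
    by rewrite !nthp ?(ltnW (ltn_ord r)) // pS addKn.
  have E2 : (chain_config n ch).2 = hv.2.
    apply/funext => r; apply/funext => c.
    rewrite -[LHS]/(mult (nth [::] ch r) c) /mult.
    have ler : (r <= n)%N by rewrite -ltnS.
    rewrite !nthp //; have [_ <-] := pv r ler (ltn_ord r) c.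
    by congr (hv.2 _ _); apply: val_inj.
  by rewrite [RHS]surjective_pairing -E1 -E2.
exists ch => //; apply/and4P; split.
- rewrite mem_chains szch eqxx; apply/allP => k /(nthP [::])[r].
  rewrite szch ltnS => le <-; rewrite /= mem_box chE // size_mkseq eqxx.
  apply/all_leP => c; rewrite -chE // nthp //; apply: leq_trans (ple r c le) _.
  exact/all_leP/all_le_sumn.
- apply/eqP/(@eq_from_nth _ 0%N) => [|c _].
    by rewrite chE // size_mkseq size_pad.
  by rewrite nthp // nth_pad.
- apply/eqP/(@eq_from_nth _ 0%N) => [|c _].
    by rewrite chE // size_mkseq size_pad.
  by rewrite nthp // nth_pad pn.
- rewrite chain_weightE; apply/prodf_neq0 => r _.
  rewrite -(row_weight_chain x (L := L)) ?chE ?size_mkseq ?(ltnW (ltn_ord r)) //.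
    by rewrite cfgE whv.
  by rewrite -!chE ?(ltnW (ltn_ord r)).
Qed.

Lemma sqW_rows_from :
  sqW q s la mu x = rows_from (pad L mu) (rev zs) (pad L la).
Proof.
rewrite -(@sum_chains N L) ?size_zs; last first.
  rewrite mem_box size_pad // eqxx; apply/all_leP => i; rewrite nth_pad.
  exact/all_leP/all_le_sumn.
pose G := [seq ch <- chains (box N L) n.+1 | good ch].
transitivity (\sum_(ch <- G) chain_weight zs ch); last first.
  rewrite big_filter [RHS]big_mkcond [LHS]big_mkcond big_seq [RHS]big_seq.
  apply: eq_bigr => ch chb; rewrite /good chb /=.
  case: (_ == pad L mu) => //=; case: (_ == pad L la) => //=.
  by case: eqP.
have goodG : [set` G] = [set ch | good ch].
  apply/seteqP; split=> ch /=; rewrite mem_filter; first by case/andP.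
  by move=> gch; rewrite gch; case/and4P: gch.
rewrite fsbig_seq ?filter_uniq ?chains_uniq ?box_uniq // goodG.
(* By [config_good], admissible configurations that are not images of good chains contribute 0. *)
rewrite /sqW -(@fsbig_widen _ _ _ _ (chain_config n @` [set ch | good ch])).
- rewrite fsbig_image; last exact: good_inj.
  by apply: eq_fsbigr => ch; rewrite inE => /good_row_weights.
- by move=> _ [ch gch <-]; apply: good_admissible.
- move=> hv [ahv nghv] /=; apply/eqP/negP => /negP/(config_good ahv)[ch gch E].
  by apply: nghv; exists ch.
Qed.

End Configurations.

End Reduction.

Lemma pad_rcons L la : (size la <= L)%N -> pad L.+1 la = rcons (pad L la) 0%N.
Proof.
move=> le; rewrite /pad subSn // -cats1 -catA; congr (_ ++ _).
by rewrite -[[:: 0%N]]/(nseq 1 0%N) -nseqD addn1.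
Qed.

Lemma pad_nil L : pad L [::] = nseq L 0%N.
Proof. by rewrite /pad subn0. Qed.

Lemma interlace_sorted la mu : interlace la mu -> sorted geq la.
Proof.
move=> lamu; apply/(sortedP 0%N) => i _; have [h1 h2] := lamu i.
exact: leq_trans h2 h1.
Qed.

Lemma part_sorted (la : int_partition) : sorted geq la.
Proof. by case: la => la /= /andP[]. Qed.

Lemma part_nth_neq0 (la : int_partition) i :
  (i < size la)%N -> nth 0%N la i != 0%N.
Proof.
case: la => la /= /andP[_ la0] lt; apply: contraNneq la0 => <-.
exact: mem_nth.
Qed.

(** * Dual weights and the conclusion *)

Section Dual.
Variables (C : numFieldType) (q s : C).
Hypothesis qfact_neq0 : forall n, qpoch q q n != 0.
Hypothesis qpoch_s2_neq0 : forall n, qpoch (s ^+ 2) q n != 0.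

(** As [ctilde] is the inverse of [gaps], this is the passage from F to F^* for one row, written
    without division. *)
Lemma gaps_rowV y la nu :
  gaps q s la * rowV q s y la nu = gaps q s nu * rowU q s y la nu.
Proof.
elim: la nu => [|l la IHla] [|n nu] //=; rewrite ?mulr0 //.
transitivity (ext (gapw q s) l (head 0%N la) * ext (upw q s y) l n *
  ext (downw q s y) n (head 0%N la) * ext (gapw q s) n (head 0%N nu)
  * (gaps q s la * rowV q s y la nu)); first by ring.
by rewrite IHla; ring.
Qed.

Lemma gaps_prod la M : (size la <= M)%N ->
  gaps q s la = \prod_(c < M) ext (gapw q s) (nth 0%N la c) (nth 0%N la c.+1).
Proof.
elim: la M => [|l la IHla] M.
  by move=> _; rewrite big1 // => c _; rewrite !nth_nil ext_id gap0.
by case: M => // M leM; rewrite big_ord_recl /= (IHla M) // nth0.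
Qed.

Lemma ctilde_gaps L la : sorted geq la -> (size la <= L)%N ->
  ctilde q s la = (gaps q s (pad L la))^-1.
Proof.
move=> srt le; rewrite (@gaps_prod _ L) ?size_pad //.
under eq_bigr do rewrite !nth_pad.
rewrite -gaps_prod // (@gaps_prod la (size la)) // -prodfV.
apply: eq_bigr => c _; rewrite /ext sorted_geq_nth // -/(mult la c).
by rewrite /gapw invf_div.
Qed.

Lemma gaps_neq0 la : sorted geq la -> gaps q s la != 0.
Proof.
move=> srt; rewrite (@gaps_prod la (size la)) //; apply/prodf_neq0 => c _.
by rewrite /ext sorted_geq_nth // /gapw mulf_neq0 ?invr_eq0.
Qed.

Lemma sorted_pad L la : sorted geq la -> sorted geq (pad L la).
Proof.
move=> srt; apply/(sortedP 0%N) => i _; rewrite !nth_pad.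
exact: sorted_geq_nth.
Qed.

Lemma dual_sqW_rowV y la nu L : sorted geq la -> sorted geq nu ->
  (size la <= L)%N -> (size nu <= L)%N ->
  dual_sqW q s la nu (fun _ : 'I_1 => y) = rowV q s y (pad L la) (pad L nu).
Proof.
move=> srt srt' le le'; rewrite /dual_sqW (@sqW_rows_from _ q s _ _ _ _ L) //.
have -> : [seq y | _ <- enum 'I_1] = [:: y] by rewrite enum_ordSl enum_ord0.
rewrite rows_from1 !(@ctilde_gaps L) // invrK.
have h := gaps_neq0 (sorted_pad L srt).
by apply: (mulfI h); rewrite gaps_rowV mulrA mulrA divff ?mul1r.
Qed.

Lemma sqW_rows n (x : 'I_n -> C) la L : sorted geq la -> (size la <= L)%N ->
  sqW q s la [::] x = rows q s (rev [seq x i | i <- enum 'I_n]) (pad L la).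
Proof.
move=> srt le; rewrite (@sqW_rows_from _ q s _ _ _ _ L) // pad_nil.
by rewrite -{1}(size_pad le) rows_from_nseq0.
Qed.

Lemma sqW_eq0 n (x : 'I_n -> C) (la : int_partition) :
  (n < size la)%N -> sqW q s la [::] x = 0.
Proof.
move=> lt; rewrite (sqW_rows x (part_sorted la) (leqnn _)).
apply/eqP; apply: contraTT (part_nth_neq0 lt) => /rows_neq0/(_ n).
by rewrite size_rev size_map size_enum_ord leqnn nth_pad => -> //; rewrite eqxx.
Qed.

Lemma rows_nseq0 xs L : rows q s xs (nseq L 0%N) = 1.
Proof.
elim: xs => [|x xs IHxs]; first by rewrite rows_nil all_nseq eqxx orbT.
rewrite (@rows_consE _ _ _ 0) ?all_nseq ?orbT // size_nseq box0 big_seq1.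
by rewrite IHxs rowU_nseq0 mulr1.
Qed.

(** Interlacing with the zero list leaves only one-row [la]; the leading 1 is the term i = 0. *)
Lemma sum_box_single xs y N L :
  \sum_(la <- box N L.+1) rows q s xs la * rowV q s y la (nseq L.+1 0%N)
  = 1 + \sum_(1 <= i < N.+1) upw q s y i * rows q s xs (i :: nseq L 0%N).
Proof.
have head0 : head 0%N (nseq L 0%N) = 0%N by case: (L).
transitivity (\sum_(0 <= i < N.+1) upw q s y i * rows q s xs (i :: nseq L 0%N)).
  rewrite big_boxS; apply: eq_bigr => i _.
  rewrite (@big_box_supp _ _ N 0) => [|t szt /eqP].
    rewrite box0 big_seq1 mulrC -[nseq L.+1 _]/(0%N :: nseq L 0%N).
    rewrite [rowV _ _ _ _ _]/= head0 rowV_nseq0 !ext_id ext_0 down0 gap0.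
    by rewrite !mulr1.
  rewrite mulf_eq0 negb_or => /andP[_ /rowV_neq0[_ tnu]].
  split; apply/all_leP => j; have [_] := tnu j; rewrite nth_nseq if_same leqn0;
    by move=> /= /eqP ->.
by rewrite big_ltn // -[0%N :: nseq L 0%N]/(nseq L.+1 0%N) rows_nseq0 up0 mulr1.
Qed.

End Dual.

Theorem mainTheorem10 (R : realType) (m : nat) (hm : (0 < m)%N)
    (nu : int_partition) (q s y : R[i]) (x : 'I_m -> R[i])
    (hq : `|q| < 1) (hs : `|s| < 1) (hy : `|y| < 1)
    (hx : forall i, `|x i| < 1) :
  exists T : R[i],
    series_from 1
      (fun i => xpoch y s q i / qpoch q q i * sqW q s [:: i] [::] x) T /\
    has_sum
      (fun la : int_partition =>
         sqW q s la [::] x * dual_sqW q s la nu (fun _ : 'I_1 => y))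
      ((1 + T) * sqW q s nu [::] x).
Proof.
have [[q1 s1] y1] := (nrm_lt1 hq, nrm_lt1 hs, nrm_lt1 hy).
pose xs := rev [seq x i | i <- enum 'I_m].
have xs1 z : z \in xs -> Normc.normc z < 1.
  by rewrite mem_rev => /mapP[i _ ->]; apply: nrm_lt1.
have szxs : size xs = m by rewrite size_rev size_map size_enum_ord.
have qn0 := qfact_neq0 q1; have sn0 := qpoch_s2_neq0 q1 s1.
(* [L] has to bound both the number of variables, as [pieri_cvg] requires, and the length of [nu],
   so that [nu] can be padded. *)
pose L := (m + size nu)%N.
have szL : (size xs <= L)%N by rewrite szxs leq_addr.
have nuL : (size nu <= L)%N by apply: leq_addl.
have [P hP] := pieri_cvg q1 s1 y1 xs1 szL.
(* For the zero list in place of [nu] the limit is [P] itself, and by [sum_box_single] it is also 1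
   + T. *)
exists (P - 1); split.
  have rcons_nseq0 : rcons (nseq L 0%N) 0%N = nseq L.+1 0%N.
    by rewrite -cats1 -[[:: 0%N]]/(nseq 1 0%N) -nseqD addn1.
  have h := hP (nseq L 0%N) (size_nseq _ _).
  rewrite rcons_nseq0 rows_nseq0 mulr1 in h.
  apply/climP => e /((climP _ _).1 h)[N HN].
  (* Partial sums of the series stop before their index, whereas a box includes its bound; hence the
     shift by one. *)
  exists N.+1 => -[//|n] /HN; rewrite sum_box_single.
  rewrite opprB addrA (addrC _ 1); congr (Normc.normc (_ + _ - _) < _).
  apply: eq_big_nat => i /andP[lt0i _].
  have si : sorted geq [:: i] by [].
  by rewrite (sqW_rows q s x si (ltn0Sn L)) /pad /= subn1.
pose nu0 := rcons (pad L nu) 0%N.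
pose g la := rows q s xs la * rowV q s y la nu0.
have -> : (fun la : int_partition =>
    sqW q s la [::] x * dual_sqW q s la nu (fun _ : 'I_1 => y))
  = (fun la : int_partition => if (size la <= L.+1)%N then g (pad L.+1 la) else 0).
  (* A partition with more than L + 1 parts has more than m parts, and its [sqW] vanishes. *)
  apply/funext => la; case: leqP => [le|lt]; last first.
    by rewrite sqW_eq0 ?mul0r // (leq_ltn_trans _ lt) // leqW // leq_addr.
  rewrite (sqW_rows _ _ _ (part_sorted la) le) /g /nu0 -pad_rcons //.
  by rewrite (@dual_sqW_rowV _ _ _ _ _ _ _ _ L.+1) ?part_sorted // leqW.
have -> : (1 + (P - 1)) * sqW q s nu [::] x = P * rows q s xs nu0.
  rewrite (sqW_rows _ _ _ (part_sorted nu) (leqW nuL)) pad_rcons //.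
  by rewrite addrC subrK.
have [B hB] := pieri_abs_bounded q1 s1 y1 xs1 (size_pad nuL).
apply: (has_sum_box (g := g) (B := B)) => [la _||//].
  rewrite /g mulf_eq0 negb_or => /andP[_ /rowV_neq0[_ h]].
  exact: interlace_sorted h.
exact: hP (pad L nu) (size_pad nuL).
Qed.
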